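(* Let $\Bbbk$ be a field, let $S = \Bbbk [x_1 , \dots , x_n]$ ($n \geq 2$) be a standard-graded polynomial ring and let $M = S/I$ be an Artinian complete intersection, where $I = (f_1 , \dots , f_n)$ is generated by a homogeneous regular sequence with degrees $\underline{d} := (d_1 \leq d_2 \leq \cdots \leq d_n)$, $d_i := \deg f_i$. Write $|\underline{d}|=d_1+\cdots+d_n$ and let $a\in\mathbb{Z}$. Then: (1) If $I$ is not generated by linear forms and $$a < d_1+d_2+n - |\underline{d}| \quad\text{or}\quad a > d_{n-1} + d_n,$$ then $S/I$ is $a$-rigid. (2) If $I$ is generated by linear forms, then $S/I$ is $a$-rigid for all $a \neq 2$.
   Context: A differential module $(D,d)$ is an $S$-module $D$ with an $S$-endomorphism $d$ such that $d^2=0$. It is of degree $a$ if $D$ is graded and $d\colon D\to D(a)$ is a graded map. Morphisms are graded $S$-module maps commuting with the endomorphisms. All modules are finitely generated. For a homogeneous complex $(C_\bullet,\partial)$ (differentials of degree $0$), $\operatorname{Fold}^a(C_\bullet)$ is the degree $a$ differential module $(\bigoplus_i C_i(ia),\partial)$. A free flag is a differential module $D$ with a splitting $D=\bigoplus_{i\in\mathbb{Z}}G_i$, each $G_i$ free, $G_i=0$ for $i<0$, and $d(G_i)\subseteq\bigoplus_{j<i}G_j$; its anchor is the complex with terms $G_i$ and differentials $G_i\to G_{i-1}$ the components of $d$. A degree $a$ free flag is anchored on a homogeneous complex $\mathbf{F}$ if it has underlying module $\bigoplus_i F_i(ia)$ and its anchor is $\mathbf{F}$ with $F_i$ twisted by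 $ia$. A homogeneous complex $\mathbf{F}$ of free modules is $a$-rigid if every degree $a$ free flag anchored on $\mathbf{F}$ is isomorphic (as a degree $a$ differential module) to $\operatorname{Fold}^a(\mathbf{F})$. A graded $S$-module is $a$-rigid if some (equivalently every) homogeneous free resolution of it is $a$-rigid. *)

(* Defs.v *)
From HB Require Import structures.
From mathcomp Require Import all_boot all_order all_algebra ring_quotient.
From mathcomp Require Import boolp.
From mathcomp Require Import mpoly.

Set Implicit Arguments.
Unset Strict Implicit.
Unset Printing Implicit Defensive.

Import Order.TTheory GRing.Theory Num.Theory.
Local Open Scope ring_scope.

(* Finitely generated Z-graded modules over S = k[x_1..x_n], with the         *)
(* standard grading of S; [hcomp M e] is the homogeneous component M_e.       *)
(* [hcomp_span] and [hcomp_direct] together say that M is the direct sum of   *)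
(* the M_e.                                                                   *)
Record grModule (k : fieldType) (n : nat) := GrModule {
  gm_sort :> lmodType {mpoly k[n]};
  hcomp : int -> gm_sort -> Prop;
  hcomp0 : forall e, hcomp e 0;
  hcompB : forall e x y, hcomp e x -> hcomp e y -> hcomp e (x - y);
  hcompZ : forall (j : nat) (p : {mpoly k[n]}) e x,
    p \is j.-homog -> hcomp e x -> hcomp (e + j%:Z) (p *: x);
  hcomp_span : forall x, exists (s : seq int) (c : int -> gm_sort),
    (forall e, hcomp e (c e)) /\ x = \sum_(e <- s) c e;
  hcomp_direct : forall (s : seq int) (c : int -> gm_sort),
    uniq s -> (forall e, hcomp e (c e)) -> \sum_(e <- s) c e = 0 ->
    forall e, e \in s -> c e = 0;
  gm_fingen : exists (r : nat) (g : 'I_r -> gm_sort),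
    forall x, exists c : 'I_r -> {mpoly k[n]}, x = \sum_i c i *: g i
}.

(* free in the graded sense: a finite homogeneous basis, i.e. M is a finite   *)
(* direct sum of twists S(-e_i)                                               *)
Definition gr_free (k : fieldType) (n : nat) (M : grModule k n) : Prop :=
  exists (r : nat) (b : 'I_r -> M) (deg : 'I_r -> int),
    (forall i, hcomp (deg i) (b i)) /\
    (forall x : M, exists! c : {ffun 'I_r -> {mpoly k[n]}},
       x = \sum_i c i *: b i).

Definition homogeneous_map (k : fieldType) (n : nat) (M N : grModule k n)
    (a : int) (phi : M -> N) : Prop :=
  forall e x, hcomp e x -> hcomp (e + a) (phi x).

Section Twist.
Context (k : fieldType) (n : nat) (M : grModule k n) (a : int).

Definition twist_comp (e : int) (x : M) : Prop := hcomp (e + a) x.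

Fact twist_compZ (j : nat) (p : {mpoly k[n]}) e x :
  p \is j.-homog -> twist_comp e x -> twist_comp (e + j%:Z) (p *: x).
Proof. by rewrite /twist_comp addrAC; apply: hcompZ. Qed.

Fact twist_span (x : M) : exists (s : seq int) (c : int -> M),
  (forall e, twist_comp e (c e)) /\ x = \sum_(e <- s) c e.
Proof.
have [s [c [hc ->]]] := hcomp_span x.
exists [seq e - a | e <- s], (fun e => c (e + a)); split=> [e|]; first exact: hc.
by rewrite big_map; apply: eq_bigr => e _; rewrite subrK.
Qed.

Fact twist_direct (s : seq int) (c : int -> M) :
  uniq s -> (forall e, twist_comp e (c e)) -> \sum_(e <- s) c e = 0 ->
  forall e, e \in s -> c e = 0.
Proof.
move=> us hc sum0 e es.
have := @hcomp_direct _ _ M [seq e + a | e <- s] (fun e => c (e - a)).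
rewrite map_inj_uniq ?us; last exact: addIr.
move=> /(_ isT) H; rewrite -[e](addrK a); apply: H; last exact: map_f.
- by move=> i; have := hc (i - a); rewrite /twist_comp subrK.
- by rewrite big_map -[RHS]sum0; apply: eq_bigr => i _; rewrite addrK.
Qed.

(* M(a), with M(a)_e = M_(e + a) *)
Definition twist : grModule k n :=
  @GrModule k n M twist_comp (fun e => hcomp0 M (e + a))
    (fun e => @hcompB _ _ M (e + a)) twist_compZ twist_span twist_direct
    (gm_fingen M).

End Twist.

Definition dsum_type (R : nzRingType) (N : nat) (M : nat -> lmodType R) :=
  {dffun forall i : 'I_N, M i}.

Section DirectSumLmod.
Context (R : nzRingType) (N : nat) (M : nat -> lmodType R).
Local Notation T := (dsum_type N M).
Implicit Types x y z : T.

HB.instance Definition _ := Choice.copy T {dffun forall i : 'I_N, M i}.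

Definition dsum_zero : T := [ffun i => 0].
Definition dsum_opp x : T := [ffun i => - x i].
Definition dsum_add x y : T := [ffun i => x i + y i].
Definition dsum_scale (c : R) x : T := [ffun i => c *: x i].

Fact dsum_addA : associative dsum_add.
Proof. by move=> x y z; apply/ffunP=> i; rewrite !ffunE addrA. Qed.
Fact dsum_addC : commutative dsum_add.
Proof. by move=> x y; apply/ffunP=> i; rewrite !ffunE addrC. Qed.
Fact dsum_add0 : left_id dsum_zero dsum_add.
Proof. by move=> x; apply/ffunP=> i; rewrite !ffunE add0r. Qed.
Fact dsum_addN : left_inverse dsum_zero dsum_opp dsum_add.
Proof. by move=> x; apply/ffunP=> i; rewrite !ffunE addNr. Qed.

HB.instance Definition _ :=
  GRing.isZmodule.Build T dsum_addA dsum_addC dsum_add0 dsum_addN.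

Fact dsum_scaleA c d x : dsum_scale c (dsum_scale d x) = dsum_scale (c * d) x.
Proof. by apply/ffunP=> i; rewrite !ffunE scalerA. Qed.
Fact dsum_scale1 : left_id 1 dsum_scale.
Proof. by move=> x; apply/ffunP=> i; rewrite !ffunE scale1r. Qed.
Fact dsum_scaleDr : right_distributive dsum_scale +%R.
Proof. by move=> c x y; apply/ffunP=> i; rewrite !ffunE scalerDr. Qed.
Fact dsum_scaleDl x : {morph dsum_scale^~ x : c d / c + d}.
Proof. by move=> c d; apply/ffunP=> i; rewrite !ffunE scalerDl. Qed.

HB.instance Definition _ := GRing.Zmodule_isLmodule.Build R T
  dsum_scaleA dsum_scale1 dsum_scaleDr dsum_scaleDl.

Lemma dsum0E (i : 'I_N) : (0 : T) i = 0.
Proof. by rewrite ffunE. Qed.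
Lemma dsumDE x y (i : 'I_N) : (x + y) i = x i + y i.
Proof. by rewrite ffunE. Qed.
Lemma dsumBE x y (i : 'I_N) : (x - y) i = x i - y i.
Proof. by rewrite !ffunE. Qed.
Lemma dsumZE c x (i : 'I_N) : (c *: x) i = c *: x i.
Proof. by rewrite ffunE. Qed.
Lemma dsum_sumE (I : Type) (s : seq I) (P : pred I) (F : I -> T) (i : 'I_N) :
  (\sum_(j <- s | P j) F j) i = \sum_(j <- s | P j) F j i.
Proof.
by elim/big_rec2: _ => [|j y1 y2 _ <-]; rewrite ?dsum0E ?dsumDE.
Qed.

(* Component i of x, and inclusion of the summand M_i; both are zero if       *)
(* i >= N.                                                                    *)
Definition dsum_coord (i : nat) (x : T) : M i :=
  if @idP (i < N)%N is ReflectT h then x (Ordinal h) else 0.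

Definition dsum_incl (i : nat) (y : M i) : T :=
  if @idP (i < N)%N is ReflectT h then
    [ffun j => @dfwith _ (fun j : 'I_N => M j : Type) (fun j => 0)
                 (Ordinal h) y j]
  else 0.

Lemma dsum_coord_ord (i : 'I_N) x : dsum_coord i x = x i.
Proof.
case: i => i hi; rewrite /dsum_coord /=; case: {-}_ / idP => // h.
by rewrite (bool_irrelevance h hi).
Qed.

Lemma dsum_coord_linear i : linear (@dsum_coord i).
Proof.
move=> c x y; rewrite /dsum_coord; case: {-}_ / idP => [h|_].
  by rewrite dsumDE dsumZE.
by rewrite scaler0 addr0.
Qed.
HB.instance Definition _ i :=
  GRing.isLinear.Build R T (M i) _ (@dsum_coord i) (@dsum_coord_linear i).

Lemma dsum_incl_linear i : linear (@dsum_incl i).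
Proof.
move=> c x y; rewrite /dsum_incl; case: {-}_ / idP => [h|_]; last first.
  by rewrite scaler0 addr0.
apply/ffunP=> j; rewrite dsumDE dsumZE !ffunE.
have [<-|ne] := eqVneq (Ordinal h) j; first by rewrite !dfwith_in.
by rewrite !dfwith_out // scaler0 addr0.
Qed.
HB.instance Definition _ i :=
  GRing.isLinear.Build R (M i) T _ (@dsum_incl i) (@dsum_incl_linear i).

Lemma dsum_inclK i (y : M i) : (i < N)%N -> dsum_coord i (dsum_incl y) = y.
Proof.
rewrite /dsum_coord /dsum_incl => hi; case: {-}_ / idP => [h|//].
by rewrite ffunE dfwith_in.
Qed.

Lemma dsum_coord_incl i j (y : M i) :
  i != j -> dsum_coord j (dsum_incl y) = 0.
Proof.
rewrite /dsum_coord /dsum_incl => ne; case: {-}_ / idP => [hj|//].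
case: {-}_ / idP => [hi|_]; last by rewrite dsum0E.
by rewrite ffunE dfwith_out.
Qed.

Lemma dsum_inclE x : x = \sum_(i < N) dsum_incl (x i).
Proof.
apply/ffunP=> j; rewrite dsum_sumE -dsum_coord_ord (bigD1 j) //=.
rewrite big1 ?addr0 => [|i ne].
  by rewrite -[X in _ = X]dsum_coord_ord dsum_inclK // dsum_coord_ord.
by rewrite -dsum_coord_ord dsum_coord_incl // .
Qed.

End DirectSumLmod.

Lemma big_collect (V : zmodType) (s : seq int) (c : int -> V) (s' : seq int) :
  uniq s' -> {subset s <= s'} ->
  \sum_(e <- s) c e = \sum_(e <- s') c e *+ count_mem e s.
Proof.
move=> us'; elim: s => [_|z s IH sub].
  by rewrite big_nil big1 // => e _; rewrite mulr0n.
rewrite big_cons IH => [|e es]; last by apply: sub; rewrite inE es orbT.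
under [RHS]eq_bigr do rewrite /= mulrnDr.
rewrite big_split /=; congr (_ + _).
rewrite (bigD1_seq z) //= ?eqxx ?mulr1n; last by apply: sub; rewrite mem_head.
by rewrite big1 ?addr0 // => e; rewrite eq_sym => /negPf ->.
Qed.

Section DirectSum.
Context (k : fieldType) (n : nat) (N : nat) (M : nat -> grModule k n).
Local Notation T := (dsum_type N (fun i => gm_sort (M i))).

Definition dsum_comp (e : int) (x : T) : Prop := forall i : 'I_N, hcomp e (x i).

Fact dsum_comp0 e : dsum_comp e 0.
Proof. by move=> i; rewrite dsum0E; apply: hcomp0. Qed.

Fact dsum_compB e x y : dsum_comp e x -> dsum_comp e y -> dsum_comp e (x - y).
Proof. by move=> hx hy i; rewrite dsumBE; apply: hcompB. Qed.

Fact dsum_compZ (j : nat) (p : {mpoly k[n]}) e x :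
  p \is j.-homog -> dsum_comp e x -> dsum_comp (e + j%:Z) (p *: x).
Proof. by move=> hp hx i; rewrite dsumZE; apply: hcompZ. Qed.

Fact dsum_span (x : T) : exists (s : seq int) (c : int -> T),
  (forall e, dsum_comp e (c e)) /\ x = \sum_(e <- s) c e.
Proof.
pose P (i : 'I_N) (sc : seq int * (int -> M i)) :=
  (forall e, hcomp e (sc.2 e)) /\ x i = \sum_(e <- sc.1) sc.2 e.
have ex (i : 'I_N) : exists sc, P i sc.
  by have [s [c h]] := hcomp_span (x i); exists (s, c).
pose sc (i : 'I_N) := projT1 (cid (ex i)).
have hsc i : P i (sc i) by rewrite /sc; case: (cid _).
pose s := undup (flatten [seq (sc i).1 | i <- enum 'I_N]).
exists s, (fun e => [ffun i => (sc i).2 e *+ count_mem e (sc i).1]); split.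
  move=> e i; rewrite ffunE; elim: (count_mem _ _) => [|m IH].
    by rewrite mulr0n; apply: hcomp0.
  rewrite mulrS -[X in _ + X]opprK; apply: hcompB; first exact: (hsc i).1.
  by rewrite -sub0r; apply: hcompB => //; apply: hcomp0.
apply/ffunP=> i; rewrite dsum_sumE (hsc i).2 (@big_collect _ _ _ s) ?undup_uniq //.
  by apply: eq_bigr => e _; rewrite ffunE.
move=> e es; rewrite mem_undup; apply/flattenP; exists (sc i).1 => //.
by apply: map_f; rewrite mem_enum.
Qed.

Fact dsum_direct (s : seq int) (c : int -> T) :
  uniq s -> (forall e, dsum_comp e (c e)) -> \sum_(e <- s) c e = 0 ->
  forall e, e \in s -> c e = 0.
Proof.
move=> us hc sum0 e es; apply/ffunP=> i; rewrite dsum0E.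
apply: (@hcomp_direct _ _ (M i) s (fun e => c e i)) => // [z|]; first exact: hc.
by rewrite -(dsum_sumE s xpredT c i) sum0 dsum0E.
Qed.

Fact dsum_fingen : exists (r : nat) (g : 'I_r -> T),
  forall x, exists c : 'I_r -> {mpoly k[n]}, x = \sum_i c i *: g i.
Proof.
have ex (i : 'I_N) : exists rg : {r : nat & 'I_r -> M i},
    forall x, exists c : 'I_(tag rg) -> {mpoly k[n]},
      x = \sum_j c j *: tagged rg j.
  by have [r [g h]] := gm_fingen (M i); exists (Tagged _ g).
pose rg (i : 'I_N) := projT1 (cid (ex i)).
have hrg (i : 'I_N) (x : M i) : exists c : 'I_(tag (rg i)) -> {mpoly k[n]},
    x = \sum_j c j *: tagged (rg i) j.
  by move: x; rewrite /rg; case: (cid _).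
pose J := {i : 'I_N & 'I_(tag (rg i))}.
pose g (j : J) : T :=
  @dsum_incl _ N (fun i => gm_sort (M i)) (tag j) (tagged (rg (tag j)) (tagged j)).
exists #|{: J}|, (fun j => g (enum_val j)) => x.
pose c (i : 'I_N) := projT1 (cid (hrg i (x i))).
have hc i : x i = \sum_j c i j *: tagged (rg i) j by rewrite /c; case: (cid _).
exists (fun j => c (tag (enum_val j)) (tagged (enum_val j))).
rewrite -(big_enum_val (fun j : J => c (tag j) (tagged j) *: g j)) /=.
rewrite [LHS]dsum_inclE.
pose h (i : 'I_N) (j : 'I_(tag (rg i))) : T :=
  @dsum_incl _ N (fun i => gm_sort (M i)) i (c i j *: tagged (rg i) j).
transitivity (\sum_(i < N) \sum_(j < tag (rg i)) h i j).
  by apply: eq_bigr => i _; rewrite /h -linear_sum -hc.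
rewrite (sig_big_dep xpredT (fun i => xpredT) h) /=.
by apply: eq_bigr => j _; rewrite /h /g linearZ.
Qed.

(* M_0 (+) ... (+) M_(N-1) *)
Definition dsum : grModule k n :=
  @GrModule k n T dsum_comp dsum_comp0 dsum_compB dsum_compZ dsum_span dsum_direct
    dsum_fingen.

End DirectSum.

(* A bounded complex of f.g. graded modules, in nonnegative homological       *)
(* degrees, with differentials of degree 0. Boundedness, witnessed by [clen], *)
(* is what makes the folded module below finitely generated; [clen] may       *)
(* exceed the actual length.                                                  *)
Record complex (k : fieldType) (n : nat) := Complex {
  cterm :> nat -> grModule k n;
  clen : nat;
  cdiff : forall i, {linear cterm i.+1 -> cterm i};
  cterm0 : forall i, (clen <= i)%N -> forall x : cterm i, x = 0;
  cdiff_homog : forall i, homogeneous_map 0 (cdiff i);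
  cdiff_sq : forall i x, cdiff i (cdiff i.+1 x) = 0
}.

Record diffModule (k : fieldType) (n : nat) (a : int) := DiffModule {
  dm_mod :> grModule k n;
  dm_d : {linear dm_mod -> dm_mod};
  dm_homog : homogeneous_map a dm_d;
  dm_sq : forall x, dm_d (dm_d x) = 0
}.

Definition diff_iso (k : fieldType) (n : nat) (a : int)
    (D E : diffModule k n a) : Prop :=
  exists phi : {linear D -> E},
    [/\ bijective phi, homogeneous_map 0 phi
      & forall x, phi (dm_d D x) = dm_d E (phi x)].

(* the terms F_i(ia) *)
Definition fold_term (k : fieldType) (n : nat) (a : int) (F : complex k n)
  (i : nat) : grModule k n := twist (F i) (i%:Z * a).

Section Fold.
Context (k : fieldType) (n : nat) (a : int) (F : complex k n).
Local Notation D := (dsum (clen F) (fold_term a F)).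

Definition fold_fun (x : D) : D :=
  [ffun i : 'I_(clen F) => cdiff F i (dsum_coord i.+1 x)].

Fact fold_linear : linear fold_fun.
Proof.
move=> c x y; apply/ffunP=> i.
by rewrite dsumDE dsumZE !ffunE !linearP.
Qed.
HB.instance Definition _ :=
  GRing.isLinear.Build {mpoly k[n]} D D _ fold_fun fold_linear.

Fact fold_homog : homogeneous_map a fold_fun.
Proof.
move=> e x hx /=; rewrite /dsum_comp => i; rewrite ffunE /dsum_coord.
case: {-}_ / idP => [h|_]; last by rewrite linear0; apply: hcomp0.
have E : e + i.+1%:Z * a = e + a + i%:Z * a.
  by rewrite -addn1 PoszD mulrDl mul1r -addrA [a + _]addrC.
have hx1 : @hcomp _ _ (F i.+1) (e + i.+1%:Z * a) (x (Ordinal h)).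
  exact: hx (Ordinal h).
by have := cdiff_homog hx1; rewrite addr0 E.
Qed.

Fact fold_sq (x : D) : fold_fun (fold_fun x) = 0.
Proof.
apply/ffunP=> i; rewrite dsum0E ffunE /dsum_coord.
by case: {-}_ / idP => [h|_]; rewrite ?linear0 // ffunE cdiff_sq.
Qed.

Definition Fold : diffModule k n a :=
  @DiffModule k n a D fold_fun fold_homog fold_sq.

End Fold.

(* A degree a free flag with underlying module G_0 (+) ... (+) G_(N-1).       *)
(* [ff_tri] says that d(G_i) lies in the sum of the G_j with j < i.           *)
Record freeFlag (k : fieldType) (n : nat) (a : int) (N : nat)
    (G : nat -> grModule k n) := FreeFlag {
  ff_d : {linear dsum N G -> dsum N G};
  ff_homog : homogeneous_map a ff_d;
  ff_sq : forall x, ff_d (ff_d x) = 0;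
  ff_free : forall i, (i < N)%N -> gr_free (G i);
  ff_tri : forall i j (x : G i),
    (i <= j)%N -> dsum_coord j (ff_d (dsum_incl N x)) = 0
}.

Coercion flag_diffModule (k : fieldType) (n : nat) (a : int) (N : nat)
    (G : nat -> grModule k n) (D : freeFlag a N G) : diffModule k n a :=
  DiffModule (ff_homog D) (ff_sq D).

(* the differential G_(i+1) -> G_i of the anchor *)
Definition flag_anchor (k : fieldType) (n : nat) (a : int) (N : nat)
    (G : nat -> grModule k n) (D : freeFlag a N G) (i : nat)
    (x : G i.+1) : G i :=
  dsum_coord i (ff_d D (dsum_incl N x)).

Definition anchored_on (k : fieldType) (n : nat) (a : int) (F : complex k n)
    (D : freeFlag a (clen F) (fold_term a F)) : Prop :=
  forall i (x : F i.+1), flag_anchor D x = cdiff F i x.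

Definition rigid_complex (k : fieldType) (n : nat) (a : int)
    (F : complex k n) : Prop :=
  forall D : freeFlag a (clen F) (fold_term a F),
    anchored_on D -> diff_iso D (Fold a F).

Definition free_resolution (k : fieldType) (n : nat) (M : grModule k n)
    (F : complex k n) : Prop :=
  (forall i, gr_free (F i)) /\
  exists eps : {linear F 0%N -> M},
    [/\ homogeneous_map 0 eps,
        forall y, exists x, eps x = y,
        forall x, eps x = 0 <-> exists y, cdiff F 0%N y = x
      & forall i x, cdiff F i x = 0 <-> exists y, cdiff F i.+1 y = x].

Definition rigid_module (k : fieldType) (n : nat) (a : int)
    (M : grModule k n) : Prop :=
  exists F : complex k n, free_resolution M F /\ rigid_complex a F.

Definition artinian (R : nzRingType) (M : lmodType R) : Prop :=
  forall U : nat -> M -> Prop,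
    (forall i, [/\ U i 0, forall x y, U i x -> U i y -> U i (x + y)
                 & forall c x, U i x -> U i (c *: x)]) ->
    (forall i x, U i.+1 x -> U i x) ->
    exists m, forall i x, (m <= i)%N -> U m x -> U i x.

(* the ideal (f_0, ..., f_(r-1)) generated by a finite sequence *)
Definition ideal_of (R : comNzRingType) (f : seq R) (p : R) : Prop :=
  exists c : nat -> R, p = \sum_(i < size f) c i * f`_i.

Definition regular_sequence (R : comNzRingType) (f : seq R) : Prop :=
  ~ ideal_of f 1 /\
  forall i p, (i < size f)%N ->
    ideal_of (take i f) (f`_i * p) -> ideal_of (take i f) p.

Definition generated_by_linear_forms (k : fieldType) (n : nat)
    (I : {mpoly k[n]} -> Prop) : Prop :=
  exists g : seq {mpoly k[n]},
    (forall p, p \in g -> p \is 1.-homog) /\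
    (forall p, I p <-> ideal_of g p).

Section QuotientModule.
Context (R : comNzRingType) (f : seq R).

Definition ideal_pred : {pred R} := [pred p | `[< ideal_of f p >]].

Lemma ideal_predP p : reflect (ideal_of f p) (p \in ideal_pred).
Proof. exact: asboolP. Qed.

Lemma ideal_of_closed c p q :
  ideal_of f p -> ideal_of f q -> ideal_of f (c * p - q).
Proof.
move=> [u ->] [v ->]; exists (fun i => c * u i - v i).
by rewrite mulr_sumr -sumrB; apply: eq_bigr => i _; rewrite mulrBl mulrA.
Qed.

Lemma ideal_of0 : ideal_of f 0.
Proof. by exists (fun=> 0); rewrite big1 // => i _; rewrite mul0r. Qed.

Fact ideal_pred_zmod : zmod_closed ideal_pred.
Proof.
split=> [|p q /ideal_predP hp /ideal_predP hq]; apply/ideal_predP.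
  exact: ideal_of0.
by rewrite -[p]mul1r; apply: ideal_of_closed.
Qed.
HB.instance Definition _ := GRing.isZmodClosed.Build R ideal_pred ideal_pred_zmod.

Definition quot_type : Type := Quotient.quot ideal_pred.
HB.instance Definition _ := GRing.Zmodule.on quot_type.

Definition quot_proj (p : R) : quot_type := \pi_(Quotient.quot ideal_pred)%qT p.

Lemma quot_projB p q : quot_proj (p - q) = quot_proj p - quot_proj q.
Proof. exact: (raddfB (\pi_(Quotient.quot ideal_pred)%qT)). Qed.
HB.instance Definition _ :=
  GRing.isZmodMorphism.Build R quot_type quot_proj quot_projB.

Lemma quot_projP (x : quot_type) : exists p, x = quot_proj p.
Proof. by exists (repr x); rewrite /quot_proj reprK. Qed.

Lemma quot_proj0 p : quot_proj p = 0 <-> ideal_of f p.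
Proof.
rewrite -[0](raddf0 quot_proj); split=> [/eqP|].
  by rewrite -Quotient.idealrBE subr0 => /ideal_predP.
by move=> h; apply/eqP; rewrite -Quotient.idealrBE subr0; apply/ideal_predP.
Qed.

Definition quot_scale (c : R) (x : quot_type) : quot_type :=
  quot_proj (c * repr x).

Lemma quot_scaleE c p : quot_scale c (quot_proj p) = quot_proj (c * p).
Proof.
apply/eqP; rewrite -subr_eq0 -quot_projB -mulrBr; apply/eqP/quot_proj0.
have : ideal_of f (repr (quot_proj p) - p).
  by apply/quot_proj0; rewrite quot_projB /quot_proj reprK subrr.
by move=> h; rewrite -[_ * _]subr0; apply: ideal_of_closed h ideal_of0.
Qed.

Fact quot_scaleA c d x : quot_scale c (quot_scale d x) = quot_scale (c * d) x.
Proof. by have [p ->] := quot_projP x; rewrite !quot_scaleE mulrA. Qed.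
Fact quot_scale1 : left_id 1 quot_scale.
Proof. by move=> x; have [p ->] := quot_projP x; rewrite quot_scaleE mul1r. Qed.
Fact quot_scaleDr : right_distributive quot_scale +%R.
Proof.
move=> c x y; have [p ->] := quot_projP x; have [q ->] := quot_projP y.
by rewrite -raddfD !quot_scaleE mulrDr raddfD.
Qed.
Fact quot_scaleDl x : {morph quot_scale^~ x : c d / c + d}.
Proof.
by move=> c d; have [p ->] := quot_projP x; rewrite !quot_scaleE mulrDl raddfD.
Qed.

HB.instance Definition _ := GRing.Zmodule_isLmodule.Build R quot_type
  quot_scaleA quot_scale1 quot_scaleDr quot_scaleDl.

Lemma quot_projZ c p : quot_proj (c * p) = c *: quot_proj p.
Proof. by rewrite -quot_scaleE. Qed.

End QuotientModule.

(* the homogeneous component S_e of the polynomial ring, for e an integer *)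
Definition poly_comp (k : fieldType) (n : nat) (e : int) (p : {mpoly k[n]}) :=
  if e is Posz j then p \is j.-homog else p == 0.

Section GradedQuotient.
Context (k : fieldType) (n : nat) (f : seq {mpoly k[n]})
  (f_homog : forall p, p \in f -> p \is homog mdeg).
Local Notation Q := (quot_type f).

Definition quot_comp (e : int) (x : Q) : Prop :=
  exists2 p, poly_comp e p & x = quot_proj f p.

Fact quot_comp0 e : quot_comp e 0.
Proof. by exists 0; [case: e => j //=; apply: dhomog0 | rewrite raddf0]. Qed.

Fact quot_compB e x y : quot_comp e x -> quot_comp e y -> quot_comp e (x - y).
Proof.
move=> [p hp ->] [q hq ->]; exists (p - q); last by rewrite raddfB.
case: e hp hq => j /=; first exact: rpredB.
by move=> /eqP-> /eqP->; rewrite subrr.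
Qed.

Fact quot_compZ (j : nat) (p : {mpoly k[n]}) e x :
  p \is j.-homog -> quot_comp e x -> quot_comp (e + j%:Z) (p *: x).
Proof.
move=> hp [q hq ->]; exists (p * q); last by rewrite quot_projZ.
case: e hq => [m|m] hq.
  by rewrite -PoszD addnC; apply: dhomogM.
rewrite (eqP hq) mulr0 /poly_comp; case: (_ + _) => // ?.
exact: dhomog0.
Qed.

Fact quot_span (x : Q) : exists (s : seq int) (c : int -> Q),
  (forall e, quot_comp e (c e)) /\ x = \sum_(e <- s) c e.
Proof.
have [p ->] := quot_projP x.
exists [seq Posz i | i <- iota 0 (msize p)].
exists (fun e => if e is Posz j then quot_proj f (pihomog mdeg j p) else 0).
split=> [[j|j]|]; [ | exact: quot_comp0 | ].
  by exists (pihomog mdeg j p) => //=; apply: pihomogP.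
rewrite {1}(@pihomog_partitionE _ _ mdeg (msize p) p) //= raddf_sum big_map /=.
by rewrite -[in RHS](subn0 (msize p)) big_mkord.
Qed.

Lemma ideal_pihomog e p : ideal_of f p -> ideal_of f (pihomog mdeg e p).
Proof.
case=> c ->; rewrite raddf_sum /=.
have H (i : 'I_(size f)) : exists u, pihomog mdeg e (c i * f`_i) = u * f`_i.
  have /homogP[d hd] := f_homog (mem_nth 0 (ltn_ord i)).
  exists (\sum_(j < msize (c i) | (j + d)%N == e) pihomog mdeg j (c i)).
  rewrite {1}(@pihomog_partitionE _ _ mdeg (msize (c i)) (c i)) //.
  rewrite mulr_suml raddf_sum mulr_suml [RHS]big_mkcond /=.
  apply: eq_bigr => j _.
  have hj := dhomogM (pihomogP mdeg j (c i)) hd.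
  case: eqP => [<-|/eqP ne]; first by rewrite pihomog_dE.
  by rewrite (pihomog_ne0 ne hj).
have [u hu] := choice H.
exists (fun i => if @idP (i < size f)%N is ReflectT h then u (Ordinal h) else 0).
apply: eq_bigr => -[i hi] _; rewrite hu /=; case: {-}_ / idP => // h.
by rewrite (bool_irrelevance h hi).
Qed.

Fact quot_direct (s : seq int) (c : int -> Q) :
  uniq s -> (forall e, quot_comp e (c e)) -> \sum_(e <- s) c e = 0 ->
  forall e, e \in s -> c e = 0.
Proof.
move=> us hc sum0 e es.
have hc' z : exists p, poly_comp z p /\ c z = quot_proj f p.
  by have [p ? ?] := hc z; exists p.
have [p hp] := choice hc'.
case: e es => [j|j] es; last by have [/eqP + ->] := hp (Negz j) => ->; rewrite raddf0.
have : ideal_of f (\sum_(e <- s) p e).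
  by apply/quot_proj0; rewrite raddf_sum -[RHS]sum0; apply: eq_bigr => z _; case: (hp z).
move=> /(ideal_pihomog j); rewrite raddf_sum (bigD1_seq _ es us) /= big1.
  have [h ->] := hp (Posz j).
  by rewrite addr0 pihomog_dE // => /quot_proj0.
move=> [m|m] ne; last by have [/eqP-> _] := hp (Negz m); rewrite raddf0.
have [h _] := hp (Posz m).
by apply: (pihomog_ne0 _ h); apply: contraNneq ne => ->.
Qed.

Fact quot_fingen : exists (r : nat) (g : 'I_r -> Q),
  forall x, exists c : 'I_r -> {mpoly k[n]}, x = \sum_i c i *: g i.
Proof.
exists 1%N, (fun=> quot_proj f 1) => x; have [p ->] := quot_projP x.
by exists (fun=> p); rewrite big_ord1 -quot_projZ mulr1.
Qed.

(* S/I for I generated by the homogeneous polynomials f *)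
Definition quot_module : grModule k n :=
  @GrModule k n Q quot_comp quot_comp0 quot_compB quot_compZ quot_span
    quot_direct quot_fingen.

End GradedQuotient.

(* Main.v *)
(** Resolve S/I by the Koszul complex K of f, whose i-th term has generators of
    degrees d_T, |T| = i. Given a flag D anchored on K, an isomorphism from D to
    Fold(K) of the form (identity + terms lowering the homological degree) is built
    on K_0, K_1, K_2, ... in turn: extending it to a generator of K_i of degree d_T
    means finding a preimage under the Koszul differential of a cycle of Fold(K)
    supported in K_0, ..., K_(i-2). Exactness gives one in positive homological
    degrees; in K_0 = S the obstruction has degree d_T - (i-1)a, and it is harmless
    if I contains all of S in that degree. This holds when the degree is negative, or
    when it exceeds |d| - n, the top degree of the Hilbert series
    prod_i (1 + t + ... + t^(d_i - 1)) of S/I. The hypotheses on a put each of these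
    degrees (|T| >= 2) in one of the two ranges. *)

From HB Require Import structures.
Require Import Defs.
From mathcomp Require Import all_boot all_order all_algebra.
From mathcomp Require Import boolp mpoly.
From mathcomp Require Import zify ring.

Set Implicit Arguments.
Unset Strict Implicit.
Unset Printing Implicit Defensive.

Import Order.TTheory GRing.Theory Num.Theory.
Local Open Scope ring_scope.

(** * Ideals and Hilbert functions *)

Lemma ideal_ofD (R : comNzRingType) (f : seq R) p q :
  ideal_of f p -> ideal_of f q -> ideal_of f (p + q).
Proof.
move=> hp hq; have -> : p + q = 1 * p - (-1 * q - 0) by ring.
by apply: ideal_of_closed => //; apply: ideal_of_closed => //; apply: ideal_of0.
Qed.

Lemma ideal_ofMl (R : comNzRingType) (f : seq R) c p :
  ideal_of f p -> ideal_of f (c * p).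
Proof.
by move=> hp; rewrite -[_ * _]subr0; apply: ideal_of_closed => //; apply: ideal_of0.
Qed.

Lemma ideal_of_sum (R : comNzRingType) (f : seq R) (J : Type) (s : seq J)
    (P : pred J) (F : J -> R) :
  (forall j, P j -> ideal_of f (F j)) -> ideal_of f (\sum_(j <- s | P j) F j).
Proof.
move=> h; elim/big_rec: _ => [|j q Pj hq]; first exact: ideal_of0.
by apply: ideal_ofD => //; apply: h.
Qed.

Lemma ideal_of_mem (R : comNzRingType) (f : seq R) p : p \in f -> ideal_of f p.
Proof.
move=> /(nthP 0)[i ip <-]; exists (fun j => (j == i)%:R).
rewrite (bigD1 (Ordinal ip)) //= eqxx mul1r big1 ?addr0 // => j.
by rewrite -val_eqE /= => /negPf->; rewrite mul0r.
Qed.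

Lemma ideal_of_sub (R : comNzRingType) (f g : seq R) p :
  (forall q, q \in f -> ideal_of g q) -> ideal_of f p -> ideal_of g p.
Proof.
move=> h [c ->]; apply: ideal_of_sum => i _.
by apply/ideal_ofMl/h/mem_nth.
Qed.

Lemma ideal_of_take (R : comNzRingType) (f : seq R) m p :
  ideal_of (take m f) p -> ideal_of f p.
Proof. by apply: ideal_of_sub => q /mem_take; apply: ideal_of_mem. Qed.

Lemma ideal_of_nil (R : comNzRingType) (p : R) : ideal_of [::] p <-> p = 0.
Proof.
by split=> [[c ->]|->]; [rewrite big_ord0 | apply: ideal_of0].
Qed.

Lemma ideal_of_takeS (R : comNzRingType) (f : seq R) m p : (m < size f)%N ->
  ideal_of (take m.+1 f) p <->
  exists c q, ideal_of (take m f) q /\ p = q + c * f`_m.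
Proof.
move=> hm; split=> [[c ->]|[c [q [hq ->]]]].
  rewrite size_takel // big_ord_recr /= nth_take //.
  exists (c m); eexists; split; last by [].
  apply: ideal_of_sum => i _; rewrite nth_take ?(ltn_trans (ltn_ord i)) //.
  apply/ideal_ofMl/ideal_of_mem.
  by rewrite -(nth_take 0 (ltn_ord i)) mem_nth // size_takel // ltnW.
apply: ideal_ofD.
  apply: ideal_of_sub hq => r hr; apply: ideal_of_mem.
  by rewrite (take_nth 0) // mem_rcons inE hr orbT.
apply/ideal_ofMl/ideal_of_mem.
by rewrite (take_nth 0) // mem_rcons inE eqxx.
Qed.

Lemma regular_sequence_neq0 (R : comNzRingType) (f : seq R) i :
  regular_sequence f -> (i < size f)%N -> f`_i != 0.
Proof.
move=> [h1 h] hi; apply/eqP => f0; case: h1.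
apply: (@ideal_of_take _ f i); apply: h => //.
by rewrite f0 mul0r; apply: ideal_of0.
Qed.

Section HomogMul.
Context (k : fieldType) (n : nat) (d : nat) (f : {mpoly k[n]}).
Context (hf : f \is d.-homog).

Lemma pihomogMr e c : pihomog mdeg (d + e) (c * f) = pihomog mdeg e c * f.
Proof.
(* The bound is raised to [e.+1] so that degree [e] indexes a term of the decomposition even when it
   exceeds the degree of [c]. *)
rewrite {1}(@pihomog_partitionE _ _ mdeg (maxn (msize c) e.+1) c) ?leq_maxl //.
rewrite mulr_suml raddf_sum /=.
have he : (e < maxn (msize c) e.+1)%N by rewrite leq_max ltnSn orbT.
rewrite (bigD1 (Ordinal he)) //= big1 ?addr0 => [|j].
  by rewrite pihomog_dE // addnC; apply: dhomogM => //; apply: pihomogP.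
rewrite -val_eqE /= => ne.
apply: (@pihomog_ne0 _ _ _ (j + d)%N); last by apply: dhomogM => //; apply: pihomogP.
by rewrite addnC eqn_add2l.
Qed.

Lemma pihomogMr_lt e c : (e < d)%N -> pihomog mdeg e (c * f) = 0.
Proof.
move=> ed; rewrite {1}(@pihomog_partitionE _ _ mdeg (msize c) c) //.
rewrite mulr_suml raddf_sum /= big1 // => j _.
apply: (@pihomog_ne0 _ _ _ (j + d)%N); last by apply: dhomogM => //; apply: pihomogP.
by rewrite gtn_eqF // (leq_trans ed) // leq_addl.
Qed.

(** Multiplication by [f] is made a [k]-linear map between finite-dimensional graded pieces, so that
    dimensions can be counted. *)
Definition dhomog_mulr e (p : dhomog n k e) : dhomog n k (d + e) :=
  DHomog (dhomogM hf (dhomog_is_dhomog p)).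

Lemma dhomog_mulr_linear e : linear (@dhomog_mulr e).
Proof.
by move=> c p q; apply/val_inj; rewrite /= mulrDr scalerAr.
Qed.
HB.instance Definition _ e := GRing.isLinear.Build k (dhomog n k e)
  (dhomog n k (d + e)) _ (@dhomog_mulr e) (@dhomog_mulr_linear e).

End HomogMul.

Lemma dim_dhomog (k : fieldType) n e :
  \dim (fullv : {vspace dhomog n.+1 k e}) = 'C(e + n, e).
Proof. by rewrite dimvf. Qed.

(** * Hilbert series of quotients by regular sequences, modulo powers of [X] *)

Section Hilbert.
Context (k : fieldType) (n : nat).
Local Notation S := {mpoly k[n.+1]}.

Definition graded_part (I : S -> Prop) (V : forall e, {vspace dhomog n.+1 k e}) :=
  forall e p, p \in V e <-> I (val p).

(** This is the Hilbert function of the quotient when [V] is the graded part of an ideal: the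
    binomial is the dimension of [S_e] in [n.+1] variables. *)
Definition hilb (V : forall e, {vspace dhomog n.+1 k e}) e : rat :=
  'C(e + n, e)%:R - (\dim (V e))%:R.

(** With [I] the old ideal, the new one is [I_e + f_m S_(e-d)] in degree [e]. Regularity makes the
    intersection of the two summands equal to [f_m I_(e-d)], and multiplication by [f_m] is
    injective, so the dimension formula for a sum yields [H'(e) = H(e) - H(e-d)]. *)
Lemma graded_part_step (f : seq S) (d : seq nat) m
    (V : forall e, {vspace dhomog n.+1 k e}) :
  (forall i, (i < size f)%N -> f`_i \is (nth 0%N d i).-homog) ->
  regular_sequence f -> (m < size f)%N ->
  graded_part (ideal_of (take m f)) V ->
  exists V', graded_part (ideal_of (take m.+1 f)) V' /\
    forall e, hilb V' e = hilb V e - (if (e < (nth 0%N d m))%N then 0 else hilb V (e - (nth 0%N d m))).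
Proof.
move=> hd hreg hm hV.
have fm := hd _ hm.
have hI e q : ideal_of (take m f) q -> ideal_of (take m f) (pihomog mdeg e q).
  apply: ideal_pihomog => p /(nthP 0)[i + <-]; rewrite size_takel ?(ltnW hm) // => im.
  rewrite nth_take //; apply/homogP; exists (nth 0%N d i); apply: hd.
  exact: ltn_trans im hm.
suff H e : exists V' : {vspace dhomog n.+1 k e},
   (forall p, p \in V' <-> ideal_of (take m.+1 f) (val p)) /\
   ('C(e + n, e)%:R - (\dim V')%:R : rat) =
    hilb V e - (if (e < (nth 0%N d m))%N then 0 else hilb V (e - (nth 0%N d m))).
  have ch e : {V' : {vspace dhomog n.+1 k e} |
   (forall p, p \in V' <-> ideal_of (take m.+1 f) (val p)) /\
   ('C(e + n, e)%:R - (\dim V')%:R : rat) =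
    hilb V e - (if (e < (nth 0%N d m))%N then 0 else hilb V (e - (nth 0%N d m)))} by apply: cid.
  by exists (fun e => sval (ch e)); split=> e; [|rewrite {1}/hilb]; case: (ch e) => V' [].
case: (ltnP e (nth 0%N d m)) => [ed|].
  exists (V e); split=> [p|]; last by rewrite subr0.
  split=> [/hV hp|]; first by apply/ideal_of_takeS => //; exists 0, (val p); rewrite mul0r addr0.
  move=> /(ideal_of_takeS _ hm)[c [q [hq E]]].
  apply/hV; rewrite -(pihomog_dE (dhomog_is_dhomog p)) E raddfD /=.
  by rewrite (pihomogMr_lt fm) // addr0; apply: hI.
(* The degree is rewritten as [d_m + e], so that the codomain type of multiplication by [f_m]
   matches without a cast. *)
move=> de; rewrite -(subnKC de); move: (e - (nth 0%N d m))%N => {de}e.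
rewrite addKn.
set mu := linfun (dhomog_mulr fm (e:=e)).
have muE q : val (mu q) = f`_m * val q by rewrite lfunE.
exists (V ((nth 0%N d m) + e)%N + limg mu)%VS; split=> [p|].
  split.
    move=> /memv_addP[u hu [v /memv_imgP[w _ ->] ->]].
    apply/ideal_of_takeS => //; exists (val w), (val u); split; first exact/hV.
    by rewrite /= -[mpoly_of_dhomog (mu w)]/(val (mu w)) muE mulrC.
  move=> /(ideal_of_takeS _ hm)[c [q [hq E]]].
  have Ep : val p = pihomog mdeg ((nth 0%N d m) + e) q + pihomog mdeg e c * f`_m.
    by rewrite -(pihomog_dE (dhomog_is_dhomog p)) E raddfD /= (pihomogMr fm).
  apply/memv_addP; exists (DHomog (pihomogP mdeg ((nth 0%N d m) + e) q)).
    by apply/hV => /=; apply: hI.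
  exists (mu (DHomog (pihomogP mdeg e c))); first by rewrite memv_img ?memvf.
  by apply/val_inj; rewrite Ep /= -[mpoly_of_dhomog (mu _)]/(val (mu _)) muE /= mulrC.
have inj : (lker mu == 0)%VS.
  apply/lker0P => u v /(congr1 val); rewrite !muE => /(mulfI _) E; apply/val_inj/E.
  exact: regular_sequence_neq0.
have capE : (V ((nth 0%N d m) + e)%N :&: limg mu = mu @: V e)%VS.
  apply/vspaceP => p; rewrite memv_cap; apply/andP/idP.
    move=> [/hV hp /memv_imgP[w _ E]]; rewrite E memv_img //; apply/hV.
    by apply: hreg.2 => //; rewrite -muE -E.
  move=> /memv_imgP[w /hV hw ->]; split; last by rewrite memv_img ?memvf.
  by apply/hV; rewrite muE; apply: ideal_ofMl.
have := dimv_sum_cap (V ((nth 0%N d m) + e)%N) (limg mu); rewrite capE.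
have dimmu U : (\dim (mu @: U) = \dim U)%N.
  by apply: limg_dim_eq; rewrite (eqP inj) capv0.
rewrite !dimmu dim_dhomog => /(congr1 (fun x : nat => x%:R : rat)).
have arith (D s v v' c : rat) : s + v' = v + c -> D - s = D - v - (c - v').
  by move=> /(canRL (addrK _)) ->; rewrite !opprD !opprK !addrA.
by rewrite /hilb !natrD; apply: arith.
Qed.

(** Identities of power series are handled as congruences modulo [X^N] between rational
    polynomials. *)
Definition trunc_hilb (V : forall e, {vspace dhomog n.+1 k e}) N : {poly rat} :=
  \poly_(e < N) hilb V e.

Lemma dvdXn_coef (p : {poly rat}) N :
  'X^N %| p = [forall i : 'I_N, p`_i == 0].
Proof.
apply/idP/forallP => [/dvdpP[q ->] i|h]; first by rewrite coefMXn ltn_ord.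
rewrite -[p](poly_take_drop N) dvdp_addr ?dvdp_mull //.
suff -> : take_poly N p = 0 by rewrite dvdp0.
apply/polyP => i; rewrite coef_take_poly coef0.
by case: ifP => // iN; apply/eqP/(h (Ordinal iN)).
Qed.

Lemma geom_poly (d : nat) :
  1 - 'X^d = (1 - 'X) * \sum_(j < d) 'X^j :> {poly rat}.
Proof. by rewrite -opprB subrX1 -mulNr opprB. Qed.

(** The expansion of [1 / (1 - X)^(m+1)], with the denominator cleared. By Pascal's rule,
    multiplying the series for [m+1] by [1 - X] gives the one for [m], whence the induction. *)
Lemma bin_series N m :
  'X^N %| (1 - 'X) ^+ m.+1 * (\poly_(e < N) 'C(e + m, e)%:R : {poly rat}) - 1.
Proof.
elim: m => [|m IH].
  have -> : \poly_(e < N) 'C(e + 0, e)%:R = \sum_(j < N) 'X^j :> {poly rat}.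
    rewrite poly_def; apply: eq_bigr => i _.
    by rewrite addn0 binn scale1r.
  by rewrite expr1 -geom_poly addrAC subrr sub0r dvdpNr.
set B := \poly_(e < N) 'C(e + m.+1, e)%:R; set B' := \poly_(e < N) _ in IH.
have h : 'X^N %| (1 - 'X) * B - B'.
  rewrite dvdXn_coef; apply/forallP => -[i iN] /=.
  rewrite coefB mulrBl mul1r coefB coefXM !coef_poly iN.
  case: i iN => [|i] iN; first by rewrite !bin0 subr0 subrr.
  rewrite /= (ltnW iN) addnS addSn binS natrD.
  by rewrite -addSnnS addSn addrK subrr.
have -> : (1 - 'X) ^+ m.+2 * B - 1 =
  (1 - 'X) ^+ m.+1 * ((1 - 'X) * B - B') + ((1 - 'X) ^+ m.+1 * B' - 1).
  by rewrite exprS mulrBr addrA subrK mulrCA mulrA.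
by rewrite dvdp_add // dvdp_mull.
Qed.

(** The recursion of [graded_part_step] says that adjoining [f_m] multiplies the Hilbert series by
    [1 - X^(d_m)]. *)
Lemma trunc_hilb_series (f : seq S) (d : seq nat) m N :
  (forall i, (i < size f)%N -> f`_i \is (nth 0%N d i).-homog) ->
  regular_sequence f -> (m <= size f)%N ->
  exists V, graded_part (ideal_of (take m f)) V /\
   'X^N %| (1 - 'X) ^+ n.+1 * trunc_hilb V N - \prod_(i < m) (1 - 'X^(nth 0%N d i)).
Proof.
move=> hd hreg; elim: m => [_|m IH hm].
  exists (fun e => 0%VS); split=> [e p|].
    rewrite take0 memv0; split=> [/eqP->|/ideal_of_nil h]; first exact: ideal_of0.
    by apply/eqP/val_inj.
  rewrite big_ord0 /trunc_hilb.
  have -> : \poly_(e < N) hilb (fun=> 0%VS) e =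
    \poly_(e < N) 'C(e + n, e)%:R :> {poly rat}.
    by apply/polyP => e; rewrite !coef_poly /hilb dimv0 subr0.
  exact: bin_series.
have [V [hV IHd]] := IH (ltnW hm).
have [V' [hV' E]] := graded_part_step hd hreg hm hV.
exists V'; split=> //; rewrite big_ord_recr /=.
set P := \prod_(i < m) _ in IHd *; set dm := nth 0%N d m in E *.
have hs : 'X^N %| trunc_hilb V' N - (1 - 'X^dm) * trunc_hilb V N.
  rewrite dvdXn_coef; apply/forallP => i.
  rewrite coefB mulrBl mul1r coefB coefXnM !coef_poly ltn_ord E.
  by rewrite (leq_ltn_trans (leq_subr _ _) (ltn_ord i)) subrr.
have -> : (1 - 'X) ^+ n.+1 * trunc_hilb V' N - P * (1 - 'X^dm) =
  (1 - 'X) ^+ n.+1 * (trunc_hilb V' N - (1 - 'X^dm) * trunc_hilb V N) +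
  (1 - 'X^dm) * ((1 - 'X) ^+ n.+1 * trunc_hilb V N - P) by ring.
by rewrite dvdp_add // dvdp_mull.
Qed.

Lemma geom_prod (d : seq nat) m :
  \prod_(i < m) (1 - 'X^(nth 0%N d i)) =
  (1 - 'X) ^+ m * \prod_(i < m) \sum_(j < nth 0%N d i) 'X^j :> {poly rat}.
Proof.
elim: m => [|m IH]; first by rewrite !big_ord0 mulr1.
by rewrite !big_ord_recr /= IH geom_poly exprSr mulrACA.
Qed.

Lemma size_geom_prod (d : seq nat) m :
  (size (\prod_(i < m) \sum_(j < nth 0%N d i) 'X^j : {poly rat})%R
     <= (\sum_(i < m) (nth 0%N d i).-1).+1)%N.
Proof.
elim: m => [|m IH]; first by rewrite !big_ord0 size_poly1.
rewrite !big_ord_recr /=; apply: leq_trans (size_polyMleq _ _) _.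
have : (size (\sum_(j < nth 0%N d m) 'X^j : {poly rat})%R <= nth 0%N d m)%N.
  apply: leq_trans (size_sum _ _ _) _; apply/bigmax_leqP => j _.
  by rewrite size_polyXn.
have arith s1 s2 b x : (s1 <= b.+1 -> s2 <= x -> (s1 + s2).-1 <= (b + x.-1).+1)%N by lia.
exact: arith IH.
Qed.

(** With as many generators as variables, the powers of [1 - X], being coprime to those of [X],
    cancel. What remains is a product of geometric sums of degree at most the sum of the [d_i - 1],
    so the Hilbert function vanishes in any larger degree [e]. *)
Lemma ideal_of_large_degree (f : seq S) (d : seq nat) e (p : S) :
  (forall i, (i < size f)%N -> f`_i \is (nth 0%N d i).-homog) ->
  regular_sequence f -> size f = n.+1 ->
  (\sum_(i < n.+1) (nth 0%N d i).-1 < e)%N -> p \is e.-homog -> ideal_of f p.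
Proof.
move=> hd hreg sf he hp.
have [V [hV hdvd]] := @trunc_hilb_series f d n.+1 e.+1 hd hreg (eq_leq (esym sf)).
move: hdvd; rewrite geom_prod -mulrBr Gauss_dvdpr; last first.
  apply: coprimep_expl; apply: coprimep_expr; rewrite coprimep_sym.
  by rewrite coprimepX rootE !hornerE ?subr0 ?oppr0 ?addr0 oner_eq0.
rewrite dvdXn_coef => /forallP/(_ ord_max); rewrite coefB coef_poly ltnSn.
rewrite [X in _ - X]nth_default; last first.
  exact: leq_trans (size_geom_prod _ _) _.
rewrite subr0 /hilb subr_eq0 eqr_nat => /eqP E.
have /hV : DHomog hp \in V e.
  suff -> : V e = fullv by rewrite memvf.
  by apply/eqP; rewrite eqEdim subvf dim_dhomog E leqnn.
by rewrite take_oversize // sf.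
Qed.
End Hilbert.

(** * The Koszul complex as a tower of mapping cones *)

Section Koszul.
Context (R : comNzRingType) (f : seq R).

(* K(f_0, ..., f_m) is the mapping cone of f_m on K(f_0, ..., f_(m-1)); the nested
   fixpoint makes krank 0 m and krank i.+1 m.+1 reduce definitionally, so that
   block matrices of these sizes typecheck. *)
Fixpoint krank (i : nat) : nat -> nat :=
  match i with
  | 0 => fun=> 1%N
  | i'.+1 => fix go m := if m is m'.+1 then (go m' + krank i' m')%N else 0%N
  end.

(** Chains are row vectors and the matrix acts from the right. The minus sign makes the two copies
    of [f_m] times the differential of the second component cancel in the square. *)
Fixpoint kdiff (m i : nat) : 'M[R]_(krank i.+1 m, krank i m) :=
  match m with
  | 0 => 0
  | m'.+1 =>
    match i return 'M[R]_(krank i.+1 m'.+1, krank i m'.+1) with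
    | 0 => col_mx (kdiff m' 0) (f`_m')%:M
    | i'.+1 => block_mx (kdiff m' i'.+1) 0 (f`_m')%:M (- kdiff m' i')
    end
  end.

Lemma krank_bin i m : krank i m = 'C(m, i).
Proof.
elim: i m => [|i IHi]; first by move=> m; rewrite bin0.
by elim=> [//|m IHm]; rewrite binS -IHm -IHi.
Qed.

Definition kpair i m (u : 'rV[R]_(krank i.+1 m)) (v : 'rV[R]_(krank i m)) :
  'rV[R]_(krank i.+1 m.+1) := row_mx u v.

Lemma kpairP i m (x : 'rV[R]_(krank i.+1 m.+1)) : exists u v, x = @kpair i m u v.
Proof. by exists (lsubmx x), (rsubmx x); rewrite /kpair hsubmxK. Qed.

Lemma kpair_inj i m u v u' v' :
  @kpair i m u v = kpair u' v' -> u = u' /\ v = v'.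
Proof. exact: eq_row_mx. Qed.

Lemma kpair0 i m : @kpair i m 0 0 = 0.
Proof. exact: row_mx0. Qed.

Lemma mul_kdiff0 m u v :
  @kpair 0 m u v *m kdiff m.+1 0 = u *m kdiff m 0 + f`_m *: v.
Proof.
by rewrite /kpair /= [LHS]mul_row_col mul_mx_scalar.
Qed.

Lemma mul_kdiffS m i u v : @kpair i.+1 m u v *m kdiff m.+1 i.+1 =
  kpair (u *m kdiff m i.+1 + f`_m *: v) (- (v *m kdiff m i)).
Proof.
by rewrite /kpair /= [LHS]mul_row_block mul_mx_scalar mulmx0 add0r mulmxN.
Qed.

Lemma kdiff_sq m i (x : 'rV[R]_(krank i.+2 m)) :
  x *m kdiff m i.+1 *m kdiff m i = 0.
Proof.
elim: m i x => [|m IH] i x; first exact: mulmx0.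
have [u [v ->]] := kpairP x; rewrite mul_kdiffS.
case: i x u v => [|i] x u v.
  by rewrite mul_kdiff0 mulmxDl IH add0r -scalemxAl scalerN subrr.
rewrite mul_kdiffS mulmxDl IH add0r -scalemxAl scalerN subrr.
by rewrite mulNmx IH !oppr0 kpair0.
Qed.

Lemma kdiff0_image m (x : 'rV[R]_(krank 0 m)) : (m <= size f)%N ->
  (exists y, y *m kdiff m 0 = x) <-> ideal_of (take m f) (x 0 0).
Proof.
elim: m x => [|m IH] x hm.
  rewrite take0; split=> [[y <-]|/ideal_of_nil x0].
    by rewrite /= mulmx0 mxE; apply: ideal_of0.
  by exists 0; rewrite mulmx0; apply/matrixP => a b; rewrite !ord1 x0 mxE.
split=> [[y <-]|].
  have [u [v ->]] := kpairP y; rewrite mul_kdiff0.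
  apply/ideal_of_takeS => //; exists (v 0 0), ((u *m kdiff m 0) 0 0); split.
    by apply/(IH _ (ltnW hm)); exists u.
  by rewrite [LHS]mxE; congr (_ + _); rewrite mxE mulrC.
move=> /(ideal_of_takeS _ hm)[c [q [hq E]]].
have [u hu] : exists u : 'rV_(krank 1 m), u *m kdiff m 0 = const_mx q.
  by apply/(IH (const_mx q) (ltnW hm)); rewrite mxE.
exists (kpair u (const_mx c)); rewrite mul_kdiff0 hu.
by apply/matrixP => a b; rewrite !ord1 E !mxE mulrC.
Qed.

(** Induction along the cones. If [v] is the differential of [w], then for a cycle [(u, v)] the
    element [u + f_m w] is a cycle of the smaller complex, hence the differential of some [z], and
    [(z, -w)] maps to [(u, v)]. *)
Lemma kdiff_exact m i (x : 'rV[R]_(krank i.+1 m)) :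
  regular_sequence f -> (m <= size f)%N ->
  x *m kdiff m i = 0 -> exists y, y *m kdiff m i.+1 = x.
Proof.
move=> hreg; elim: m i x => [|m IH] i x hm.
  by move=> _; exists 0; apply/matrixP => a [].
have lift (j : nat) (u : 'rV[R]_(krank j.+1 m)) v w : v = w *m kdiff m j ->
    u *m kdiff m j + f`_m *: v = 0 ->
    exists y, y *m kdiff m.+1 j.+1 = kpair u v.
  move=> -> h; have [z hz] : exists z, z *m kdiff m j.+1 = u + f`_m *: w.
    by apply: IH; [exact: ltnW | rewrite mulmxDl -scalemxAl].
  by exists (kpair z (- w)); rewrite mul_kdiffS hz scalerN addrK mulNmx opprK.
have [u [v ->]] := kpairP x; case: i x u v => [|i] x u v.
  rewrite mul_kdiff0 => h.
  (* Here [v] lies in degree 0, where exactness says nothing; the cycle equation puts [f_m v] in the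
     earlier ideal, and regularity then puts [v] there. *)
  have [w hw] : exists w, w *m kdiff m 0 = v.
    apply/(kdiff0_image v (ltnW hm)).
    apply: hreg.2 => //.
    have -> : f`_m * v 0 0 = (f`_m *: v) 0 0 by rewrite mxE.
    apply/(kdiff0_image _ (ltnW hm)).
    by exists (- u); rewrite mulNmx; apply/eqP; rewrite eqr_oppLR -addr_eq0 h.
  exact: lift (esym hw) h.
rewrite mul_kdiffS -(kpair0 i m) => /kpair_inj[h /eqP].
rewrite oppr_eq0 => /eqP /IH -/(_ (ltnW hm))[w hw].
exact: lift (esym hw) h.
Qed.
End Koszul.

(** * Graded free modules *)

Section PolyComp.
Context (k : fieldType) (n : nat).
Implicit Types (p q : {mpoly k[n]}) (e : int).

Lemma poly_comp0 e : poly_comp e (0 : {mpoly k[n]}).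
Proof. by case: e => j //=; apply: dhomog0. Qed.

Lemma poly_compB e p q : poly_comp e p -> poly_comp e q -> poly_comp e (p - q).
Proof.
case: e => j /=; first exact: rpredB.
by move=> /eqP-> /eqP->; rewrite subrr.
Qed.

Lemma poly_compN e p : poly_comp e p -> poly_comp e (- p).
Proof. by move=> h; rewrite -sub0r; apply: poly_compB => //; apply: poly_comp0. Qed.

Lemma poly_compD e p q : poly_comp e p -> poly_comp e q -> poly_comp e (p + q).
Proof. by move=> hp hq; rewrite -[q]opprK; apply/poly_compB/poly_compN. Qed.

Lemma poly_compM (j : nat) e p q :
  q \is j.-homog -> poly_comp e p -> poly_comp (e + j%:Z) (q * p).
Proof.
move=> hq; case: e => m hp.
  by rewrite -PoszD addnC; apply: dhomogM.
by rewrite (eqP hp) mulr0; apply: poly_comp0.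
Qed.

Definition poly_part e p : {mpoly k[n]} :=
  if e is Posz j then pihomog mdeg j p else 0.

Lemma poly_partP e p : poly_comp e (poly_part e p).
Proof. by case: e => j //=; apply: pihomogP. Qed.

Lemma poly_part_id e p : poly_comp e p -> poly_part e p = p.
Proof. by case: e => j /= => [/pihomog_dE|/eqP]. Qed.

Lemma poly_part_ne e e' p : e != e' -> poly_comp e p -> poly_part e' p = 0.
Proof.
case: e e' => i [j|j] //= ne; last by move=> /eqP->; rewrite linear0.
by move=> h; apply: pihomog_ne0 h.
Qed.

Lemma poly_partD e p q : poly_part e (p + q) = poly_part e p + poly_part e q.
Proof. by case: e => j /=; rewrite ?linearD ?addr0. Qed.

Lemma poly_part_sum (s : seq int) p : uniq s ->
  (forall j, (j < msize p)%N -> Posz j \in s) ->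
  \sum_(e <- s) poly_part e p = p.
Proof.
move=> us hs; pose s' := [seq Posz j | j <- iota 0 (msize p)].
have us' : uniq s' by rewrite map_inj_uniq ?iota_uniq // => x y [].
have E : p = \sum_(e <- s') poly_part e p.
  rewrite big_map {1}(@pihomog_partitionE _ _ mdeg (msize p) p) //.
  by rewrite -(big_mkord xpredT (fun d => pihomog mdeg d p)) /index_iota subn0.
rewrite (bigID (mem s')) /= [X in _ + X]big1 ?addr0.
  rewrite -big_filter [RHS]E; apply/perm_big/uniq_perm => //.
    exact: filter_uniq.
  move=> e; rewrite mem_filter andb_idr // => /mapP[j + ->].
  by rewrite mem_iota => /andP[_ hj]; apply: hs.
move=> [j|j] //= hj.
rewrite (@pihomog_partitionE _ _ mdeg (msize p) p) // linear_sum big1 // => i _.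
apply: (pihomog_ne0 _ (pihomogP _ _ _)); apply: contraNneq hj => <-.
by apply: map_f; rewrite mem_iota /=.
Qed.

Lemma poly_comp_direct (s : seq int) (c : int -> {mpoly k[n]}) :
  uniq s -> (forall e, poly_comp e (c e)) -> \sum_(e <- s) c e = 0 ->
  forall e, e \in s -> c e = 0.
Proof.
move=> us hc E e es.
have : poly_part e (\sum_(e <- s) c e) = 0.
  by rewrite E; case: (e) => j //=; rewrite linear0.
rewrite (bigD1_seq e) //= poly_partD poly_part_id // => <-.
rewrite -[LHS]addr0; congr (_ + _); symmetry.
elim/big_rec: _ => [|e' q ne IH]; first by case: (e) => j //=; rewrite linear0.
by rewrite poly_partD IH addr0 (poly_part_ne ne).
Qed.

End PolyComp.

Section GradedModules.
Context (k : fieldType) (n : nat).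
Implicit Types M N : grModule k n.

Lemma hcompN M e (x : M) : hcomp e x -> hcomp e (- x).
Proof. by move=> h; rewrite -sub0r; apply: hcompB => //; apply: hcomp0. Qed.

Lemma hcompD M e (x y : M) : hcomp e x -> hcomp e y -> hcomp e (x + y).
Proof. by move=> hx hy; rewrite -[y]opprK; apply/hcompB/hcompN. Qed.

Lemma hcomp_sum M e (J : Type) (s : seq J) (P : pred J) (F : J -> M) :
  (forall j, P j -> hcomp e (F j)) -> hcomp e (\sum_(j <- s | P j) F j).
Proof.
move=> h; elim/big_rec: _ => [|j x Pj hx]; first exact: hcomp0.
by apply: hcompD => //; apply: h.
Qed.

Lemma hcompMn M e (x : M) j : hcomp e x -> hcomp e (x *+ j).
Proof. by move=> h; elim: j => [|j IH]; rewrite ?mulrS; [apply: hcomp0 | apply: hcompD]. Qed.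

Lemma hcomp_polyZ M e e' p (x : M) :
  poly_comp e p -> hcomp e' x -> hcomp (e' + e) (p *: x).
Proof.
case: e => j hp hx; first exact: hcompZ.
by rewrite (eqP hp) scale0r; apply: hcomp0.
Qed.

(** The degree [e] component of [x] already maps to [y]: the other components land in other degrees,
    and directness separates them. *)
Lemma homogeneous_preimage M N c (p : {linear M -> N}) e y x :
  homogeneous_map c p -> hcomp (e + c) y -> p x = y ->
  exists x', hcomp e x' /\ p x' = y.
Proof.
move=> hp hy; have [s [g [hg ->]]] := hcomp_span x.
(* The degree [e] is added in case [s] misses it; [big_collect] merges repeated degrees. *)
pose s' := undup (e :: s).
rewrite (@big_collect _ s g s') ?undup_uniq //; last first.
  by move=> z zs; rewrite mem_undup inE zs orbT.
move=> E; exists (g e *+ count_mem e s); split; first exact: hcompMn.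
(* [G z] is the degree [z] part of [p x - y], so the values of [G] sum to 0. *)
pose G (z : int) : N := p (g (z - c) *+ count_mem (z - c) s) -
  (if z == e + c then y else 0).
have : G (e + c) = 0.
  apply: (@hcomp_direct _ _ N [seq z + c | z <- s']).
  - by rewrite map_inj_uniq ?undup_uniq //; apply: addIr.
  - move=> z; apply: hcompB; last by case: eqP => [->|_] //; apply: hcomp0.
    by rewrite -{1}[z](subrK c); apply/hp/hcompMn.
  - rewrite big_map sumrB /=.
    rewrite [X in _ - X](bigD1_seq e) ?undup_uniq ?mem_undup ?mem_head //=.
    rewrite eqxx [X in _ - (_ + X)]big1 => [|z ne]; last by rewrite ifN //; apply: contra_neq ne => /addIr.
    rewrite addr0 -E linear_sum; apply/eqP; rewrite subr_eq0; apply/eqP.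
    by apply: eq_bigr => z _; rewrite addrK.
  - by apply: map_f; rewrite mem_undup mem_head.
by rewrite /G eqxx addrK => /eqP; rewrite subr_eq0 => /eqP.
Qed.

Section FreeModule.
Context (r : nat) (deg : 'I_r -> int).
Local Notation T := 'rV[{mpoly k[n]}]_r.

(** This grades the direct sum of the [S(-deg s)]: the [s]-th generator lies in degree [deg s]. *)
Definition gfree_comp e (x : T) := forall s, poly_comp (e - deg s) (x 0 s).

Fact gfree_comp0 e : gfree_comp e 0.
Proof. by move=> s; rewrite mxE; apply: poly_comp0. Qed.

Fact gfree_compB e x y : gfree_comp e x -> gfree_comp e y -> gfree_comp e (x - y).
Proof. by move=> hx hy s; rewrite !mxE; apply: poly_compB. Qed.

Fact gfree_compZ (j : nat) (p : {mpoly k[n]}) e x :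
  p \is j.-homog -> gfree_comp e x -> gfree_comp (e + j%:Z) (p *: x).
Proof. by move=> hp hx s; rewrite mxE addrAC; apply: poly_compM. Qed.

Fact gfree_span (x : T) : exists (s : seq int) (c : int -> T),
  (forall e, gfree_comp e (c e)) /\ x = \sum_(e <- s) c e.
Proof.
pose L := undup (flatten [seq [seq Posz j + deg s | j <- iota 0 (msize (x 0 s))]
  | s <- enum 'I_r]).
exists L, (fun e => \row_s poly_part (e - deg s) (x 0 s)); split=> [e s|].
  by rewrite mxE; apply: poly_partP.
apply/rowP => s; rewrite summxE.
under eq_bigr do rewrite mxE.
rewrite -(big_map (fun e => e - deg s) xpredT (fun e => poly_part e (x 0 s))).
rewrite poly_part_sum // => [|j hj].
  by rewrite map_inj_uniq ?undup_uniq //; apply: addIr.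
apply/mapP; exists (Posz j + deg s); last by rewrite addrK.
rewrite mem_undup; apply/flattenP; eexists; first by apply: map_f; rewrite mem_enum.
by apply/mapP; exists j => //; rewrite mem_iota.
Qed.

Fact gfree_direct (s : seq int) (c : int -> T) :
  uniq s -> (forall e, gfree_comp e (c e)) -> \sum_(e <- s) c e = 0 ->
  forall e, e \in s -> c e = 0.
Proof.
move=> us hc E e es; apply/rowP => t; rewrite mxE.
rewrite -[e in LHS](subrK (deg t)).
apply: (@poly_comp_direct k n [seq e - deg t | e <- s] (fun e => c (e + deg t) 0 t)).
- by rewrite map_inj_uniq //; apply: addIr.
- by move=> z; rewrite -{1}[z](addrK (deg t)); apply: hc.
- rewrite big_map; move/rowP/(_ t): E; rewrite summxE mxE => E.
  by rewrite -[RHS]E; apply: eq_bigr => z _; rewrite subrK.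
- exact: map_f.
Qed.

Fact gfree_fingen : exists (r : nat) (g : 'I_r -> T),
  forall x, exists c : 'I_r -> {mpoly k[n]}, x = \sum_i c i *: g i.
Proof.
exists r, (fun i => delta_mx 0 i) => x; exists (x 0); exact: row_sum_delta.
Qed.

Definition gfree : grModule k n :=
  @GrModule k n T gfree_comp gfree_comp0 gfree_compB gfree_compZ gfree_span
    gfree_direct gfree_fingen.

End FreeModule.

Definition homog_basis M r (b : 'I_r -> M) (deg : 'I_r -> int) :=
  (forall i, hcomp (deg i) (b i)) /\
  (forall x : M, exists! c : {ffun 'I_r -> {mpoly k[n]}}, x = \sum_i c i *: b i).

Lemma gfree_basis r (deg : 'I_r -> int) :
  homog_basis (fun s => delta_mx 0 s : gfree deg) deg.
Proof.
split=> [s t|x].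
  rewrite mxE eqxx /=; case: eqP => [->|_]; last exact: poly_comp0.
  by rewrite subrr /=; apply: dhomog1.
exists [ffun s => (x : 'rV__) 0 s]; split.
  by rewrite {1}[x]row_sum_delta; apply: eq_bigr => s _; rewrite ffunE.
move=> c E; apply/ffunP => s; rewrite ffunE E summxE (bigD1 s) //=.
rewrite mxE mxE !eqxx mulr1 big1 ?addr0 // => t ne.
by rewrite mxE mxE eqxx eq_sym (negPf ne) mulr0.
Qed.

End GradedModules.

Definition linear_pack (R : nzRingType) (U V : lmodType R) (h : U -> V)
    (hlin : linear h) : {linear U -> V} :=
  HB.pack h (GRing.isLinear.Build R U V _ h hlin).

(** * Homogeneous bases and graded lifting *)

Section HomogeneousBasis.
Context (k : fieldType) (n : nat) (M : grModule k n).
Context (r : nat) (b : 'I_r -> M) (deg : 'I_r -> int).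
Context (hb : homog_basis b deg).

Definition basis_coords (x : M) : {ffun 'I_r -> {mpoly k[n]}} :=
  projT1 (cid (hb.2 x)).

Lemma basis_coordsE x : x = \sum_i basis_coords x i *: b i.
Proof. by rewrite /basis_coords; case: cid => c [hc _] /=. Qed.

Lemma basis_coords_uniq x (c : {ffun 'I_r -> {mpoly k[n]}}) :
  x = \sum_i c i *: b i -> basis_coords x = c.
Proof. by move=> E; rewrite /basis_coords; case: cid => c' [_ uniq_c] /=; apply: uniq_c. Qed.

Lemma basis_coords_linear c x y i :
  basis_coords (c *: x + y) i = c * basis_coords x i + basis_coords y i.
Proof.
rewrite (@basis_coords_uniq _ [ffun j => c * basis_coords x j + basis_coords y j]).
  by rewrite ffunE.
rewrite {1}[x]basis_coordsE {1}[y]basis_coordsE scaler_sumr -big_split /=.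
by apply: eq_bigr => j _; rewrite ffunE scalerDl scalerA.
Qed.

Definition gfree_map (v : gfree k n deg) : M := \sum_i (v : 'rV__) 0 i *: b i.

Lemma gfree_map_linear : linear gfree_map.
Proof.
move=> c u v; rewrite /gfree_map scaler_sumr -big_split /=.
by apply: eq_bigr => j _; rewrite !mxE scalerDl scalerA.
Qed.

(** [x] is the image of its coordinate row under a degree 0 map from a graded free module. By
    [homogeneous_preimage] some homogeneous row has the same image, and uniqueness of coordinates
    identifies the two rows. *)
Lemma basis_coords_homog e x i :
  hcomp e x -> poly_comp (e - deg i) (basis_coords x i).
Proof.
move=> hx; have hp : homogeneous_map 0 (linear_pack gfree_map_linear).
  move=> e' v hv; rewrite addr0; apply: hcomp_sum => s _.
  by rewrite -(subrK (deg s) e') addrC; apply: hcomp_polyZ; [apply: hv | apply: hb.1].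
have E : linear_pack gfree_map_linear (\row_j basis_coords x j) = x.
  by rewrite [RHS]basis_coordsE; apply: eq_bigr => j _; rewrite mxE.
have hx0 : hcomp (e + 0) x by rewrite addr0.
have [v [hv Ev]] := homogeneous_preimage hp hx0 E.
rewrite (@basis_coords_uniq x [ffun j => (v : 'rV__) 0 j]); first by rewrite ffunE.
by rewrite -[LHS]Ev; apply: eq_bigr => j _; rewrite ffunE.
Qed.

Lemma homog_basis_extend (N : grModule k n) c (w : 'I_r -> N) :
  (forall s, hcomp (deg s + c) (w s)) ->
  exists h : {linear M -> N}, homogeneous_map c h /\ forall s, h (b s) = w s.
Proof.
move=> hw; pose h x := \sum_s basis_coords x s *: w s.
have hlin : linear h.
  move=> p x y; rewrite /h scaler_sumr -big_split /=.
  by apply: eq_bigr => j _; rewrite basis_coords_linear scalerDl scalerA.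
exists (linear_pack hlin); split=> [e x hx|s].
  apply: hcomp_sum => s _.
  have -> : e + c = (deg s + c) + (e - deg s) by ring.
  by apply: hcomp_polyZ => //; apply: basis_coords_homog.
rewrite /= /h (@basis_coords_uniq _ [ffun j => (j == s)%:R]).
  rewrite (bigD1 s) //= ffunE eqxx scale1r big1 ?addr0 // => j /negPf ne.
  by rewrite ffunE ne scale0r.
rewrite (bigD1 s) //= ffunE eqxx scale1r big1 ?addr0 // => j /negPf ne.
by rewrite ffunE ne scale0r.
Qed.

Lemma homog_basis_ext (V : lmodType {mpoly k[n]}) (g h : {linear M -> V}) :
  (forall s, g (b s) = h (b s)) -> g =1 h.
Proof.
move=> E x; rewrite [x]basis_coordsE !linear_sum; apply: eq_bigr => s _.
by rewrite !linearZ /= E.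
Qed.

(** Graded projectivity of a free module. Surjectivity of [p] is replaced by liftability of the
    images of the basis, since the lifts through the differentials of [F] are only available in this
    form. *)
Lemma homog_basis_lift (N N' : grModule k n) c (p : {linear N -> N'})
    (g : {linear M -> N'}) :
  homogeneous_map 0 p -> homogeneous_map c g ->
  (forall s, exists w, p w = g (b s)) ->
  exists h : {linear M -> N}, homogeneous_map c h /\ forall x, p (h x) = g x.
Proof.
move=> hp hg hw.
have hw' s : exists w, hcomp (deg s + c) w /\ p w = g (b s).
  have [w E] := hw s; apply: (homogeneous_preimage hp _ E).
  by rewrite addr0; apply/hg/hb.1.
have [w Hw] := choice hw'.
have [h [hh E]] := @homog_basis_extend N c w (fun s => (Hw s).1).
exists h; split=> // x.
apply: (@homog_basis_ext _ (p \o h : {linear M -> N'}) g) => s /=.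
by rewrite E (Hw s).2.
Qed.

End HomogeneousBasis.

(** * Triangular endomorphisms of direct sums *)

Section DirectSumTriangular.
Context (R : nzRingType) (N : nat) (M : nat -> lmodType R).
Local Notation T := (dsum_type N M).
Local Notation incl i y := (@dsum_incl R N M i y).
Implicit Types (x y : T) (U V : {linear T -> T}).

Lemma dsum_coord_ge i x : (N <= i)%N -> dsum_coord i x = 0.
Proof.
by rewrite /dsum_coord => h; case: {-}_ / idP => // i_lt; move: h; rewrite leqNgt i_lt.
Qed.

Lemma dsum_incl_ge i (y : M i) : (N <= i)%N -> incl i y = 0.
Proof.
by rewrite /dsum_incl => h; case: {-}_ / idP => // i_lt; move: h; rewrite leqNgt i_lt.
Qed.

Lemma dsum_coordP x y : (forall i, dsum_coord i x = dsum_coord i y) -> x = y.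
Proof. by move=> h; apply/ffunP => i; rewrite -!dsum_coord_ord h. Qed.

Definition dsum_below m x := forall j, (m <= j)%N -> dsum_coord j x = 0.

Lemma dsum_below_coord U V m j x :
  (forall i j (y : M i), (i <= j)%N ->
     dsum_coord j (U (incl i y)) = dsum_coord j (V (incl i y))) ->
  dsum_below m x -> (m <= j.+1)%N -> dsum_coord j (U x) = dsum_coord j (V x).
Proof.
move=> h hx mj; rewrite [x]dsum_inclE !linear_sum; apply: eq_bigr => i _.
have [ij|ij] := leqP i j; first exact: h.
by rewrite -dsum_coord_ord hx ?linear0 // (leq_trans mj).
Qed.

(** [U] is the identity up to terms strictly lowering the position, so one inducts on the highest
    position occurring. For surjectivity, [U z - z] lies lower; subtracting a preimage of it from
    [z] gives a preimage of [z]. *)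
Lemma unitriangular_bij U :
  (forall i j (y : M i), (i <= j)%N ->
     dsum_coord j (U (incl i y)) = dsum_coord j (incl i y)) -> bijective U.
Proof.
move=> h; have hU m j x : dsum_below m x -> (m <= j.+1)%N ->
    dsum_coord j (U x) = dsum_coord j x.
  exact: (@dsum_below_coord U idfun).
have belowN x : dsum_below N x by move=> j; apply: dsum_coord_ge.
have inj x : U x = 0 -> x = 0.
  move=> Ux; suff H m : dsum_below m x -> x = 0 by exact: H (belowN x).
  elim: m => [|m IH] hx; first by apply: dsum_coordP => i; rewrite linear0 hx.
  by apply: IH => j mj; rewrite -(hU _ _ _ hx) // Ux linear0.
have surj y : exists x, U x = y.
  suff H m z : dsum_below m z -> exists x, U x = z by exact: H (belowN y).
  elim: m z => [|m IH] z hz.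
    by exists 0; rewrite linear0; apply: dsum_coordP => i; rewrite linear0 hz.
  have [|x hx] := IH (U z - z).
    by move=> j mj; rewrite linearB /= (hU _ _ _ hz) // subrr.
  by exists (z - x); rewrite linearB hx opprB addrCA subrr addr0.
have [g hg] := choice surj.
exists g => [x|y //]; apply/eqP; rewrite -subr_eq0; apply/eqP/inj.
by rewrite linearB hg subrr.
Qed.

End DirectSumTriangular.

(** * Rigidity from vanishing *)

Section DirectSumHomogeneous.
Context (k : fieldType) (n N : nat) (M : nat -> grModule k n).

Lemma hcomp_dsum_coord e j (x : dsum N M) : hcomp e x -> hcomp e (dsum_coord j x).
Proof.
move=> hx; rewrite /dsum_coord; case: {-}_ / idP => [h|_]; last exact: hcomp0.
exact: hx.
Qed.

Lemma hcomp_dsum_incl e j (y : M j) :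
  hcomp e y -> hcomp e (@dsum_incl _ N (fun i => gm_sort (M i)) j y : dsum N M).
Proof.
move=> hy i; rewrite -dsum_coord_ord.
have [E|ne] := eqVneq j (nat_of_ord i); last by rewrite dsum_coord_incl //; apply: hcomp0.
by move: E y hy => -> y hy; rewrite dsum_inclK.
Qed.

End DirectSumHomogeneous.

Section Rigidity.
Context (k : fieldType) (n : nat) (a : int) (F : complex k n).
Local Notation N := (clen F).
Local Notation G := (fold_term a F).
Local Notation W := (dsum N G).
Local Notation incl p y :=
  (@dsum_incl {mpoly k[n]} N (fun i => gm_sort (G i)) p y).
Local Notation coord p y :=
  (@dsum_coord {mpoly k[n]} N (fun i => gm_sort (G i)) p y).
Local Notation bd := (dm_d (Fold a F)).

Lemma Fold_coord j (x : W) : coord j (bd x) = cdiff F j (coord j.+1 x).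
Proof.
have [jN|Nj] := ltnP j N.
  by rewrite -[j in LHS]/(nat_of_ord (Ordinal jN)) dsum_coord_ord ffunE.
rewrite dsum_coord_ge // dsum_coord_ge ?linear0 //.
exact: leqW.
Qed.

Context (D : freeFlag a N G).
Context (hD : anchored_on D).
Context (hex : forall i x, cdiff F i x = 0 -> exists y, cdiff F i.+1 y = x).

(** [phi] is always defined on the whole sum; only commutation is restricted to the first [m]
    summands. The middle condition says that [phi] is the identity plus terms lowering the
    homological degree. *)
Definition partial_iso m (phi : {linear W -> W}) := [/\ homogeneous_map 0 phi,
  forall i j (x : G i), (i <= j)%N -> coord j (phi (incl i x)) = coord j (incl i x)
  & forall i (x : G i), (i < m)%N -> phi (ff_d D (incl i x)) = bd (phi (incl i x))].

Lemma partial_iso_below m phi x : partial_iso m phi ->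
  dsum_below m x -> phi (ff_d D x) = bd (phi x).
Proof.
move=> [_ _ h] hx; rewrite [x]dsum_inclE !linear_sum /=; apply: eq_bigr => i _.
have [im|mi] := ltnP i m; first exact: h.
by rewrite -dsum_coord_ord hx // !linear0.
Qed.

Definition defect m (phi : {linear W -> W}) (x : G m) : W :=
  phi (ff_d D (incl m x)) - bd (phi (incl m x)).

Lemma defect_linear m phi : linear (@defect m phi).
Proof. by move=> c x y; rewrite /defect !linearP scalerDr addrACA. Qed.

(** Both terms of the defect lie below position [m] by triangularity, and they agree in position
    [m - 1] because the flag is anchored on [F]. *)
Lemma defect_coord m phi (x : G m) j : partial_iso m phi ->
  (m <= j.+1)%N -> coord j (defect phi x) = 0.
Proof.
move=> hphi mj; have [Nm|mN] := leqP N m.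
  by rewrite /defect dsum_incl_ge // !linear0 addr0 linear0.
have [hh htri hcomm] := hphi.
rewrite /defect linearB /= Fold_coord htri //.
have dbelow : dsum_below m (ff_d D (incl m x)) by move=> i mi; apply: ff_tri.
rewrite (@dsum_below_coord _ _ _ phi idfun m j _ htri dbelow) //=.
move: mj; rewrite leq_eqVlt => /orP[/eqP E|mj]; last first.
  by rewrite dbelow // dsum_coord_incl ?ltn_eqF // linear0 subr0.
move: E x mN {hphi hcomm dbelow} => -> x mN.
by rewrite /= dsum_inclK // -hD subrr.
Qed.

(** The flag differential of [x] lies in the summands where [phi] already commutes, so the Fold
    differential of its image is [phi (d (d x)) = 0]. *)
Lemma defect_cycle m phi (x : G m) : partial_iso m phi -> bd (defect phi x) = 0.
Proof.
move=> hphi; rewrite /defect linearB (dm_sq (d := Fold a F)) subr0.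
have dbelow : dsum_below m (ff_d D (incl m x)) by move=> j mj; apply: ff_tri.
by have := partial_iso_below hphi dbelow; rewrite ff_sq linear0 => <-.
Qed.

(** The degree [c] combines the twists of [F_m] and [F_j] by [m a] and [j a] with the degree [a] of
    the differentials. *)
Lemma defect_homog m phi c j : partial_iso m phi ->
  c = (j%:Z + 1 - m%:Z) * a ->
  homogeneous_map c (fun x : F m => coord j (defect phi x) : F j).
Proof.
move=> [hh _ _] Ec e x hx.
have hi : hcomp (e - m%:Z * a) (incl m x : W).
  by apply: hcomp_dsum_incl; rewrite /= /twist_comp subrK.
have h : hcomp (e - m%:Z * a + a) (defect phi x : W).
  have hD1 := hh _ _ (ff_homog D hi); have := hh _ _ hi.
  rewrite !addr0 in hD1 *; move=> /(@dm_homog k n a (Fold a F)) hb1.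
  exact: hcompB hD1 hb1.
have /= := hcomp_dsum_coord j h.
rewrite /twist_comp; congr hcomp; rewrite Ec; ring.
Qed.

Lemma partial_iso_step m phi : partial_iso m phi ->
  (exists r (b : 'I_r -> F m) deg, homog_basis b deg /\
     ((2 <= m)%N -> forall s (y : F 0), hcomp (deg s - (m%:Z - 1) * a) y ->
       exists x, cdiff F 0 x = y)) ->
  exists psi, partial_iso m.+1 psi.
Proof.
move=> hphi [r [b [deg [hb hvan]]]].
have ex j : exists h : {linear F m -> F j.+1},
    [/\ homogeneous_map ((j%:Z + 1 - m%:Z) * a) h,
      (m <= j.+1)%N -> forall x, h x = 0 &
      forall x, cdiff F j (h x) = coord j (defect phi x)].
  have [mj|jm] := leqP m j.+1.
    have Z : linear (fun _ : F m => 0 : F j.+1) by move=> c u v; rewrite scaler0 addr0.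
    exists (linear_pack Z); split=> // [e x _|x]; first exact: hcomp0.
    by rewrite linear0 (defect_coord _ hphi).
  have glin : linear (fun x : F m => coord j (defect phi x) : F j).
    by move=> c x y; rewrite [defect _ _](@defect_linear m phi c x y) linearP.
  have ghom := defect_homog hphi (erefl ((j%:Z + 1 - m%:Z) * a)).
  have [||s|h [hh Eh]] := @homog_basis_lift _ _ _ _ _ _ hb (F j.+1) (F j)
     ((j%:Z + 1 - m%:Z) * a) (cdiff F j) (linear_pack glin).
  - by move=> e x; apply: cdiff_homog.
  - exact: ghom.
  (* Above position 0 the coordinate is a cycle of [F] and exactness lifts it. In position 0 there
     is no cycle condition, and the hypothesis on degrees supplies the lift. *)
  - case: j jm glin ghom => [|j] jm glin ghom; last first.
      by apply: hex; rewrite /= -Fold_coord defect_cycle // linear0.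
    apply: (hvan jm s); have := ghom _ _ (hb.1 s).
    by congr hcomp; ring.
  - by exists h; split=> // mj; rewrite leqNgt jm in mj.
pose h j := projT1 (cid (ex j)).
have hh j : [/\ homogeneous_map ((j%:Z + 1 - m%:Z) * a) (h j),
    (m <= j.+1)%N -> forall x, h j x = 0 &
    forall x, cdiff F j (h j x) = coord j (defect phi x)] := projT2 (cid (ex j)).
(* For [j.+1 = N] the inclusion takes its default value 0, which is consistent since [F_N] is
   zero. *)
pose C (x : G m) : W := \sum_(j < N) incl j.+1 (h j x).
have Clin : linear C.
  move=> c x y; rewrite /C scaler_sumr -big_split /=.
  by apply: eq_bigr => j _; rewrite !linearP.
have C0 x : coord 0 (C x) = 0.
  by rewrite linear_sum big1 // => j _; apply: dsum_coord_incl.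
have CS j x : coord j.+1 (C x) = h j x.
  have [jN|Nj] := ltnP j.+1 N; last by rewrite dsum_coord_ge // [RHS]cterm0.
  rewrite linear_sum (bigD1 (Ordinal (ltnW jN))) //= dsum_inclK // big1 ?addr0 //.
  by move=> i ne; rewrite dsum_coord_incl // eqSS.
have Cbd x : bd (C x) = defect phi x.
  by apply: dsum_coordP => j; rewrite Fold_coord CS; have [_ _ ->] := hh j.
have Chom e x : hcomp e x -> hcomp e (C x : W).
  move=> hx; apply: hcomp_sum => j _; apply: hcomp_dsum_incl.
  have [hj _ _] := hh j; have := hj _ _ hx; rewrite /= /twist_comp.
  by congr hcomp; rewrite -addn1 PoszD; ring.
have Ctri j x : (m <= j)%N -> coord j (C x) = 0.
  by case: j => [|j] mj; [exact: C0 | rewrite CS; have [_ -> ] := hh j].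
have [hhom htri hcomm] := hphi.
(* The correction reads only coordinate [m], so it changes nothing on the lower summands or on the
   image of [G_m] under the flag differential. *)
have psilin : linear (fun x : W => phi x + C (coord m x)).
  by move=> c x y; rewrite !linearP /= (Clin c) scalerDr addrACA.
have CD0 : C 0 = 0 by exact: (linear0 (linear_pack Clin)).
exists (linear_pack psilin); split=> /=.
- move=> e x hx; apply: hcompD; first exact: hhom.
  by rewrite addr0; apply/Chom/(hcomp_dsum_coord m hx).
- move=> i j x ij; rewrite linearD /= htri //.
  have [E|ne] := eqVneq i m; last by rewrite [X in C X]dsum_coord_incl // CD0 linear0 addr0.
  by rewrite Ctri ?addr0 // -E.
- move=> i x; rewrite ltnS => im.
  change (phi (ff_d D (incl i x)) + C (coord m (ff_d D (incl i x))) =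
    bd (phi (incl i x) + C (coord m (incl i x)))).
  rewrite ff_tri // CD0 addr0 linearD Cbd.
  move: im; rewrite leq_eqVlt => /orP[/eqP E|im].
    move: E x => -> x; have [mN|Nm] := ltnP m N.
      by rewrite dsum_inclK // addrC subrK.
    by rewrite dsum_incl_ge // !linear0 /defect !linear0 !addr0.
  rewrite hcomm // dsum_coord_incl ?ltn_eqF //.
  by rewrite /defect !linear0 !addr0.
Qed.

End Rigidity.

Theorem rigid_complex_of_vanishing (k : fieldType) (n : nat) (a : int) (F : complex k n) :
  (forall i x, cdiff F i x = 0 -> exists y, cdiff F i.+1 y = x) ->
  (forall i, exists r (b : 'I_r -> F i) deg, homog_basis b deg /\
     ((2 <= i)%N -> forall s (y : F 0), hcomp (deg s - (i%:Z - 1) * a) y ->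
       exists x, cdiff F 0 x = y)) ->
  rigid_complex a F.
Proof.
move=> hex hb D hD.
have [phi hphi] : exists phi, partial_iso D (clen F) phi.
  suff H m : exists phi, partial_iso D m phi by exact: H.
  elim: m => [|m [phi hphi]]; last exact: partial_iso_step hphi (hb m).
  (* At stage 0 commutation is vacuous, so the identity starts the induction. *)
  exists (idfun : {linear dsum (clen F) (fold_term a F) -> _}).
  by split=> // e x; rewrite addr0.
have [hhom htri hcomm] := hphi.
exists phi; split=> //; first exact: unitriangular_bij.
by move=> x; apply: (partial_iso_below hphi) => j; apply: dsum_coord_ge.
Qed.

(** * The graded Koszul resolution *)

Section KoszulDegrees.
Context (d : seq nat).

(** The recursion follows [krank]: generators in the right block of the cone involve the newest
    element of [f] and gain its degree. The result is [d_T] for the corresponding set [T] of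
    indices. *)
Fixpoint kdeg (i : nat) : forall m, 'I_(krank i m) -> nat :=
  match i with
  | 0 => fun _ _ => 0%N
  | i'.+1 => fix go m : 'I_(krank i'.+1 m) -> nat :=
    match m return 'I_(krank i'.+1 m) -> nat with
    | 0 => fun _ => 0%N
    | m'.+1 => fun s =>
      match split (s : 'I_(krank i'.+1 m' + krank i' m')) with
      | inl s' => go m' s'
      | inr s' => (@kdeg i' m' s' + nth 0%N d m')%N
      end
    end
  end.

Lemma kdeg_lshift i m (s : 'I_(krank i.+1 m)) :
  @kdeg i.+1 m.+1 (lshift (krank i m) s) = kdeg s.
Proof. by rewrite [LHS]/= (unsplitK (inl s)). Qed.

Lemma kdeg_rshift i m (s : 'I_(krank i m)) :
  @kdeg i.+1 m.+1 (rshift (krank i.+1 m) s) = (kdeg s + nth 0%N d m)%N.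
Proof. by rewrite [LHS]/= (unsplitK (inr s)). Qed.

(** This trades generators, i.e. sets of indices, for subsequences of [d], in terms of which the
    degree bounds are stated. *)
Lemma kdeg_subseq i m (s : 'I_(krank i m)) : (m <= size d)%N ->
  exists t, [/\ subseq t (take m d), size t = i & sumn t = kdeg s].
Proof.
elim: m i s => [|m IH] [|i] s hm.
- by exists [::]; rewrite sub0seq.
- by case: s => s s0; exfalso; move: s0; rewrite /= ltn0.
- by exists [::]; rewrite sub0seq.
have hm' := ltnW hm; rewrite (take_nth 0%N) //.
rewrite -(splitK (s : 'I_(krank i.+1 m + krank i m))).
case: (split _) => s'; rewrite [unsplit _]/=.
  have [t [ht st E]] := IH _ s' hm'; exists t; split => //.
    by rewrite -cats1 (subseq_trans ht) ?prefix_subseq.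
  by rewrite kdeg_lshift.
have [t [ht st E]] := IH _ s' hm'; exists (rcons t (nth 0%N d m)); split.
- by rewrite -!cats1 cat_subseq.
- by rewrite size_rcons st.
- by rewrite kdeg_rshift sumn_rcons E.
Qed.

End KoszulDegrees.

Section KoszulComplex.
Context (k : fieldType) (n : nat) (f : seq {mpoly k[n]}) (d : seq nat).
Context (hd : forall i, (i < size f)%N -> f`_i \is (nth 0%N d i).-homog).

Local Notation kdegz i m := (fun s : 'I_(krank i m) => (kdeg d s)%:Z).

Lemma gfree_comp_kpair i m e u v :
  gfree_comp (kdegz i.+1 m.+1) e (kpair u v : 'rV[{mpoly k[n]}]_(krank i.+1 m.+1)) <->
  gfree_comp (kdegz i.+1 m) e u /\
  gfree_comp (kdegz i m) (e - (nth 0%N d m)%:Z) v.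
Proof.
split=> [h|[hu hv] s].
  split=> s.
    by have := h (lshift _ s); rewrite kdeg_lshift /kpair row_mxEl.
  have := h (rshift _ s); rewrite kdeg_rshift /kpair row_mxEr.
  by rewrite PoszD opprD addrA addrAC.
rewrite -(splitK (s : 'I_(krank i.+1 m + krank i m))); case: (split _) => s'; rewrite [unsplit _]/=.
  by rewrite kdeg_lshift /kpair row_mxEl.
by rewrite kdeg_rshift /kpair row_mxEr PoszD opprD addrA addrAC; apply: hv.
Qed.

Lemma kdiff_homog m i e (x : 'rV[{mpoly k[n]}]_(krank i.+1 m)) : (m <= size f)%N ->
  gfree_comp (kdegz i.+1 m) e x -> gfree_comp (kdegz i m) e (x *m kdiff f m i).
Proof.
elim: m i e x => [|m IH] i e x hm; first by move=> _; rewrite mulmx0; apply: gfree_comp0.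
have [u [v ->]] := kpairP x => /gfree_comp_kpair [hu hv].
have hfv j (w : 'rV_(krank j m)) : gfree_comp (kdegz j m) (e - (nth 0%N d m)%:Z) w ->
    gfree_comp (kdegz j m) e (f`_m *: w).
  by move=> hw; rewrite -[e](subrK (nth 0%N d m)%:Z); apply: gfree_compZ (hd hm) hw.
have D0 r (deg : 'I_r -> int) z y y' : gfree_comp deg z y ->
    gfree_comp deg z y' -> gfree_comp deg z (y + y' : 'rV[{mpoly k[n]}]_r).
  by move=> hy hy' s; rewrite mxE; apply: poly_compD.
have hm' := ltnW hm; case: i x u v hu hv => [|i] x u v hu hv.
  by rewrite mul_kdiff0; apply: D0; [exact: (IH 0%N e u) | exact: (hfv 0%N v)].
rewrite mul_kdiffS; apply/gfree_comp_kpair; split.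
  by apply: D0; [exact: IH | exact: hfv].
by move=> s; rewrite mxE; apply: poly_compN; apply: IH.
Qed.

Definition koszul_term i : grModule k n := gfree k n (kdegz i (size f)).

Definition koszul_diff i : {linear koszul_term i.+1 -> koszul_term i} :=
  mulmxr (kdiff f (size f) i).

(** The bound is [(size f).+1] because the term in homological degree [size f] still has rank 1. *)
Fact koszul_term0 i : ((size f).+1 <= i)%N -> forall x : koszul_term i, x = 0.
Proof.
move=> hi x; apply/rowP => -[s hs]; exfalso; move: hs.
by rewrite krank_bin bin_small.
Qed.

Fact koszul_diff_homog i : homogeneous_map 0 (koszul_diff i).
Proof. by move=> e x hx; rewrite addr0; apply: kdiff_homog. Qed.

Fact koszul_diff_sq i x : koszul_diff i (koszul_diff i.+1 x) = 0.
Proof. exact: kdiff_sq. Qed.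

Definition koszul : complex k n :=
  Complex koszul_term0 koszul_diff_homog koszul_diff_sq.

Lemma koszul_resolution (hhomog : forall p, p \in f -> p \is homog mdeg) :
  regular_sequence f -> free_resolution (quot_module hhomog) koszul.
Proof.
move=> hreg; split=> [i|].
  by do 3!eexists; apply: gfree_basis.
pose eps (x : koszul 0%N) : quot_module hhomog :=
  quot_proj f ((x : 'rV_1) 0 0).
have epslin : linear eps.
  by move=> c x y; rewrite /eps !mxE raddfD /= quot_projZ.
exists (linear_pack epslin); split.
- move=> e x hx; exists ((x : 'rV_1) 0 0) => //.
  by have := hx 0; rewrite subr0.
- by move=> y; have [p ->] := quot_projP y; exists (const_mx p); rewrite /= /eps mxE.
- move=> x; rewrite /= /eps; apply: (iff_trans (quot_proj0 _ _)); apply: iff_sym.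
  by have := kdiff0_image x (leqnn (size f)); rewrite take_size.
- move=> i x; split=> [|[y <-]]; last exact: kdiff_sq.
  exact: kdiff_exact.
Qed.

End KoszulComplex.

(** * Degree bounds for subsequences of a sorted sequence *)

Lemma subseq_sorted_nth (T : eqType) (le : rel T) (x0 : T) (d t : seq T) i :
  reflexive le -> transitive le -> sorted le d -> subseq t d -> (i < size t)%N ->
  le (nth x0 d i) (nth x0 t i).
Proof.
move=> le_refl le_trans; elim: d t i => [|x d IH] [|y t] i hs //= hsub hi.
have hsd := path_sorted hs.
case: eqP hsub => [->|_] hsub; last first.
  have := IH (y :: t) i hsd hsub hi; apply: le_trans.
  have hid : (i < size d)%N by apply: leq_trans hi (size_subseq hsub).
  case: i hi hid => [|i] hi hid /=.
    by move: hs; case: (d) hid => //= z d' _ /andP[].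
  by move: hsd => /(sortedP x0); apply.
by case: i hi => [|i] //= hi; apply: IH.
Qed.

Section DegreeBounds.
Local Open Scope nat_scope.
Context (d : seq nat).
Context (d_sorted : sorted leq d).

Lemma subseq_sorted_nth_rev (t : seq nat) i : subseq t d -> i < size t ->
  nth 0 t (size t - i.+1) <= nth 0 d (size d - i.+1).
Proof.
move=> hsub hi; have hid : i < size d by apply: leq_trans hi (size_subseq hsub).
rewrite -!nth_rev //; apply: (@subseq_sorted_nth _ geq) => //.
- exact: leqnn.
- by move=> x y z xy yz; apply: leq_trans yz xy.
- by rewrite rev_sorted.
- by rewrite subseq_rev.
- by rewrite size_rev.
Qed.

Lemma sumn_le_size (t : seq nat) b :
  (forall x, x \in t -> x <= b) -> sumn t <= size t * b.
Proof.
elim: t => //= x t IH h; rewrite mulSn leq_add ?h ?mem_head //.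
by apply: IH => y yt; apply: h; rewrite inE yt orbT.
Qed.

Lemma sumn_ge_size (t : seq nat) : (forall x, x \in t -> 0 < x) -> size t <= sumn t.
Proof.
elim: t => //= x t IH h; rewrite -add1n leq_add ?h ?mem_head //.
by apply: IH => y yt; apply: h; rewrite inE yt orbT.
Qed.

Lemma sumn_eq_size (t : seq nat) : (forall x, x \in t -> 0 < x) ->
  sumn t <= size t -> forall x, x \in t -> x = 1.
Proof.
elim: t => //= x t IH h hs y; have x0 := h x (mem_head _ _).
have ht z : z \in t -> 0 < z by move=> zt; apply: h; rewrite inE zt orbT.
have st := sumn_ge_size ht; rewrite inE => /orP[/eqP->|]; first by lia.
by apply: IH => //; lia.
Qed.

(** The last entry of [t] is at most the largest of [d], the others at most the second largest. The
    factor [(size t).-1] matches the multiple of [a] in the degree of the obstruction. *)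
Lemma subseq_sumn_le (t : seq nat) : subseq t d -> 2 <= size t ->
  sumn t <= (size t).-1 * (nth 0 d (size d - 2) + nth 0 d (size d - 1)).
Proof.
case/lastP: t => [|t v] // hsub; rewrite size_rcons /= ltnS => ht.
have sd : (size t).+1 <= size d by rewrite -(size_rcons t v) size_subseq.
have hv : v <= nth 0 d (size d - 1).
  have := @subseq_sorted_nth_rev (rcons t v) 0 hsub.
  by rewrite size_rcons subn1 /= nth_rcons ltnn eqxx; apply.
have ht' : sumn t <= size t * nth 0 d (size d - 2).
  apply: sumn_le_size => x /(nthP 0)[j jt <-].
  have := @subseq_sorted_nth_rev (rcons t v) (size t - j) hsub.
  rewrite size_rcons ltnS leq_subr => /(_ isT).
  have -> : (size t).+1 - (size t - j).+1 = j by rewrite subSS subKn // ltnW.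
  rewrite nth_rcons jt => /leq_trans; apply.
  have d0 : 0 < size d by apply: leq_trans sd.
  apply: (sorted_leq_nth leq_trans leqnn 0 d_sorted); rewrite ?inE ?ltn_subrL //.
  by rewrite leq_sub2l // ltnS subn_gt0.
rewrite sumn_rcons mulnDr leq_add // (leq_trans hv) //.
by rewrite leq_pmull.
Qed.

Context (d_gt0 : forall x, x \in d -> 0 < x).

Lemma subseq_sumn_ge (t : seq nat) : subseq t d -> 2 <= size t ->
  nth 0 d 0 + nth 0 d 1 + (size t - 2) <= sumn t.
Proof.
move=> hsub ht.
have h i (hi : i < size t) := @subseq_sorted_nth _ leq 0 d t i leqnn leq_trans d_sorted hsub hi.
case: t ht hsub h => [|u [|v t]] //= _ hsub h.
have := h 0 isT; have := h 1 isT; rewrite /= => hv hu.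
have : size t <= sumn t.
  apply: sumn_ge_size => x xt; apply: d_gt0; apply: (mem_subseq hsub).
  by rewrite !inE xt !orbT.
lia.
Qed.

Lemma sumn_pred : sumn d = \sum_(i < size d) (nth 0 d i).-1 + size d.
Proof.
rewrite -[X in _ + X]card_ord -sum1_card -big_split /= sumnE (big_nth 0) big_mkord.
by apply: eq_bigr => i _; rewrite addn1 prednK // d_gt0 // mem_nth.
Qed.

Local Close Scope nat_scope.

(** For large [a] the degree is negative by [subseq_sumn_le]. For [a <= 0] it is at least
    [sumn t - a], which [subseq_sumn_ge] places above [|d| - n]. *)
Lemma degree_bound_nonlinear (a : int) (t : seq nat) :
  (2 <= size d)%N -> ~ (forall x, x \in d -> x = 1%N) ->
  a < (nth 0%N d 0)%:Z + (nth 0%N d 1)%:Z + (size d)%:Z - (sumn d)%:Z \/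
  a > (nth 0%N d (size d - 2))%:Z + (nth 0%N d (size d - 1))%:Z ->
  subseq t d -> (2 <= size t)%N ->
  (sumn t)%:Z - ((size t)%:Z - 1) * a < 0 \/
  (sumn d)%:Z - (size d)%:Z < (sumn t)%:Z - ((size t)%:Z - 1) * a.
Proof.
move=> d2 nlin [ha|ha] hsub ht; [right|left]; last first.
  have := subseq_sumn_le hsub ht.
  move: (sumn t) (size t) (nth _ _ _) (nth _ _ _) ht ha => s p x y hp ha hs.
  nia.
have hs := subseq_sumn_ge hsub ht.
have [a0|a0] := lerP a 0.
  move: (sumn t) (size t) (nth _ _ _) (nth _ _ _) ht ha hs => s p x y hp ha hs.
  nia.
(* For [a > 0] the hypothesis bounds the sum of the degrees beyond the first two by their number, so
   each is 1; if there is any, sortedness makes all degrees 1, a contradiction. Hence [d] and [t]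
   have size 2. *)
have st2 : size t = 2%N.
  apply/eqP; rewrite eqn_leq ht andbT; apply: leq_trans (size_subseq hsub) _.
  rewrite leqNgt; apply/negP => d3; apply: nlin.
  move: d_gt0 d_sorted ha d3; case: d => [|x [|y [|z d']]] //= pos /and3P[xy yz _] ha _.
  have one w : w \in z :: d' -> w = 1%N.
    apply: sumn_eq_size; last by rewrite /=; lia.
    by move=> v vd; apply: pos; rewrite !in_cons in vd *; rewrite vd !orbT.
  have x0 : (0 < x)%N by apply: pos; rewrite mem_head.
  have y0 : (0 < y)%N by apply: pos; rewrite !inE eqxx orbT.
  have z1 := one z (mem_head _ _).
  by move=> w; rewrite !in_cons => /or3P[/eqP->|/eqP->|/one //]; lia.
move: ha hs; rewrite st2; lia.
Qed.

(** With all degrees 1 and [p = size t], the degree is [p - (p - 1) a] and the top degree of the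
    quotient is 0. The former is positive for [a <= 1] and negative for [a >= 3]; for [a = 2] and
    [p = 2] it would be 0. *)
Lemma degree_bound_linear (a : int) (t : seq nat) :
  (forall x, x \in d -> x = 1%N) -> a <> 2 ->
  subseq t d -> (2 <= size t)%N ->
  (sumn t)%:Z - ((size t)%:Z - 1) * a < 0 \/
  (sumn d)%:Z - (size d)%:Z < (sumn t)%:Z - ((size t)%:Z - 1) * a.
Proof.
move=> one a2 hsub; have onet x : x \in t -> x = 1%N by move/(mem_subseq hsub)/one.
have sum1 (s : seq nat) : (forall x, x \in s -> x = 1%N) -> sumn s = size s.
  move=> h; apply/eqP; rewrite eqn_leq sumn_ge_size ?andbT => [|x /h-> //].
  by rewrite -[leqRHS]muln1; apply: sumn_le_size => x /h->.
rewrite !sum1 // subrr; move: (size t) => p hp.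
have [a1|a1] := lerP a 1; [right|left]; nia.
Qed.
End DegreeBounds.

(** * Complete intersections and the degrees of their generators *)

Section CompleteIntersection.
Context (k : fieldType) (n : nat) (f : seq {mpoly k[n]}) (d : seq nat).
Context (f_homog : forall i, (i < size f)%N -> f`_i \is (nth 0%N d i).-homog).
Context (f_reg : regular_sequence f).
Context (size_d : size d = size f).

(** A nonzero form of degree 0 is a unit and would put 1 in the ideal. *)
Lemma regular_degree_gt0 x : x \in d -> (0 < x)%N.
Proof.
move=> /(nthP 0%N)[i]; rewrite size_d => hi <-.
rewrite lt0n; apply/eqP => di0; have := f_homog hi; rewrite di0 => h0.
have ne0 := regular_sequence_neq0 f_reg hi.
have fC : f`_i = (mcoeff 0%MM f`_i)%:MP.
  apply: msize1_polyC.
  by have := dhomog_uniq ne0 h0 (dhomog_msize h0); case: (msize _) => [|[]].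
case: f_reg => + _; apply.
have -> : 1 = ((mcoeff 0%MM f`_i)^-1)%:MP * f`_i.
  rewrite {2}fC -mpolyCM mulVf //.
  by apply: contra_neq ne0 => c0; rewrite fC c0.
by apply/ideal_ofMl/ideal_of_mem/mem_nth.
Qed.

Lemma ideal_of_homog (hn : (0 < n)%N) e p : size f = n ->
  poly_comp e p -> e < 0 \/ (sumn d)%:Z - n%:Z < e -> ideal_of f p.
Proof.
move=> sf hp he.
case: e hp he => [e hp|e /= /eqP -> _]; last exact: ideal_of0.
case=> // he.
(* The Hilbert series computation has [n] in successor form; all that depends on [n] is generalized
   before rewriting. *)
have [n' En] : exists n', n = n'.+1 by exists n.-1; rewrite prednK.
move: f f_homog f_reg size_d sf p hp he regular_degree_gt0; rewrite En.
move=> g hg rg sd sg p hp he pos.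
apply: (ideal_of_large_degree hg rg sg _ hp).
have := sumn_pred pos; rewrite sd sg => E.
by move: he; rewrite E; lia.
Qed.

(** If some degree is not 1, let [m] be the first such position. By sortedness all degrees from [m]
    on are at least 2, so linear forms in the ideal already lie in that of [f_0, ..., f_(m-1)]. If
    they generate, [f_m] lies there too, and regularity puts 1 in the ideal. *)
Lemma generated_by_linear_forms_degrees : sorted leq d ->
  generated_by_linear_forms (ideal_of f) <-> (forall x, x \in d -> x = 1%N).
Proof.
move=> d_sorted; split=> [[g [glin gI]]|one]; last first.
  exists f; split=> // p /(nthP 0)[i hi <-].
  by rewrite -(one (nth 0%N d i)) ?f_homog // mem_nth // size_d.
pose m := find (fun x => x != 1%N) d.
have [hm|] := boolP (has (fun x => x != 1%N) d); last first.
  by rewrite -all_predC => /allP h x /h /=; rewrite negbK => /eqP.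
exfalso; have md : (m < size d)%N by rewrite -has_find.
have mf : (m < size f)%N by rewrite -size_d.
have ge2 i : (m <= i)%N -> (i < size d)%N -> (1 < nth 0%N d i)%N.
  move=> mi hi.
  have : (nth 0%N d m <= nth 0%N d i)%N.
    by apply: (sorted_leq_nth leq_trans leqnn 0%N d_sorted); rewrite ?inE.
  apply: leq_trans; have := nth_find 0%N hm; rewrite -/m => /= ne1.
  by have := regular_degree_gt0 (mem_nth 0%N md); rewrite leq_eqVlt eq_sym (negPf ne1).
have gm p : p \in g -> ideal_of (take m f) p.
  move=> pg; have p1 := glin _ pg; have : ideal_of f p by apply/gI/ideal_of_mem.
  move=> [c E]; rewrite -(pihomog_dE p1) E raddf_sum; apply: ideal_of_sum => i _.
  have [im|mi] := ltnP i m; last by rewrite /= (pihomogMr_lt (f_homog _)) ?ge2 ?size_d //; apply: ideal_of0.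
  apply: ideal_pihomog.
    move=> q /mem_take/(nthP 0)[j hj <-].
    by apply/homogP; exists (nth 0%N d j); apply: f_homog.
  apply/ideal_ofMl/ideal_of_mem.
  by rewrite -(nth_take 0 im) mem_nth // size_takel // ltnW.
have fm : ideal_of (take m f) (f`_m * 1).
  rewrite mulr1; apply: (ideal_of_sub gm); apply/gI/ideal_of_mem.
  exact: mem_nth.
case: f_reg => f1 /(_ m 1 mf fm) /ideal_of_take; exact: f1.
Qed.

Lemma rigid_complete_intersection a (hhomog : forall p, p \in f -> p \is homog mdeg) :
  (0 < n)%N -> size f = n ->
  (forall t, subseq t d -> (2 <= size t)%N ->
    (sumn t)%:Z - ((size t)%:Z - 1) * a < 0 \/
    (sumn d)%:Z - n%:Z < (sumn t)%:Z - ((size t)%:Z - 1) * a) ->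
  rigid_module a (quot_module hhomog).
Proof.
move=> hn sf hvan; exists (koszul f_homog); split; first exact: koszul_resolution.
apply: rigid_complex_of_vanishing => [i x|i]; first exact: kdiff_exact.
do 3!eexists; split; first exact: gfree_basis.
move=> i2 s y hy.
apply/(kdiff0_image (y : 'rV_(krank 0 (size f))) (leqnn _)); rewrite take_size.
have [t [+ st E]] := kdeg_subseq s (eq_leq (esym size_d)).
rewrite -size_d take_size => ht.
apply: (ideal_of_homog hn sf (hy 0)); rewrite subr0 -E -st.
by apply: hvan; rewrite ?st.
Qed.
End CompleteIntersection.

Theorem theorem4p3 (k : fieldType) (n : nat) (f : n.-tuple {mpoly k[n]})
    (d : seq nat) (a : int)
    (hn : (2 <= n)%N)
    (hhomog : forall p, p \in (f : seq {mpoly k[n]}) -> p \is homog mdeg)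
    (hreg : regular_sequence f)
    (hart : artinian (quot_module hhomog))
    (hd : d = [seq (msize p).-1 | p <- f])
    (hsorted : sorted leq d) :
  (~ generated_by_linear_forms (ideal_of f) ->
   a < (nth 0%N d 0)%:Z + (nth 0%N d 1)%:Z + n%:Z - (sumn d)%:Z \/
   a > (nth 0%N d (n - 2))%:Z + (nth 0%N d (n - 1))%:Z ->
   rigid_module a (quot_module hhomog)) /\
  (generated_by_linear_forms (ideal_of f) ->
   a <> 2 -> rigid_module a (quot_module hhomog)).
Proof.
have sf := size_tuple f; have sd : size d = size f by rewrite hd size_map.
have sdn : size d = n by rewrite sd.
have f_homog i : (i < size f)%N -> f`_i \is (nth 0%N d i).-homog.
  move=> hi; rewrite hd (nth_map 0) //.
  by have /homogP[e /dhomog_msize] := hhomog _ (mem_nth 0 hi).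
have d_gt0 := regular_degree_gt0 f_homog hreg sd.
have linP := generated_by_linear_forms_degrees f_homog hreg sd hsorted.
have hn0 := ltnW hn.
(* The two parts differ only in the arithmetic that places each degree in a vanishing range. *)
split=> [nlin ha|/linP one a2];
    apply: (rigid_complete_intersection f_homog) => // t ht st; rewrite -sdn.
  by apply: degree_bound_nonlinear => //; rewrite ?sdn // => /linP.
exact: degree_bound_linear.
Qed.
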